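(* Let $M$ be a smooth manifold modelled on a Banach space. For the ''only if'' direction of (i) and for (ii), assume in addition that $M$ is partitionable, i.e. that every open cover of $M$ admits a subordinate smooth partition of unity. (i) For $k\ge2$, $\pi_k:T^kM\to M$ admits a vector bundle structure isomorphic to $\oplus_{i=1}^kTM$ if and only if $M$ is endowed with (admits) a linear connection. (ii) If for some $k\ge2$, $\pi_k:T^kM\to M$ becomes a vector bundle isomorphic to $\oplus_{i=1}^kTM$, then for every $i\in\mathbb{N}$ the tangent bundle $T^iM$ of order $i$ also admits a vector bundle structure over $M$ isomorphic to $\oplus_{j=1}^iTM$.
   Context: Let $M$ be modelled on the Banach space $\mathbb{E}$ with atlas $\{(U_\alpha,\psi_\alpha)\}_{\alpha\in I}$. For $x_0\in M$ let $C_{x_0}$ be the set of smooth curves $\gamma:(-\epsilon,\epsilon)\to M$ with $\gamma(0)=x_0$; for $k\in\mathbb{N}$, $k\ge1$, $\gamma_1\approx^k_{x_0}\gamma_2$ iff $\gamma_1^{(j)}(0)=\gamma_2^{(j)}(0)$ for $1\le j\le k$ (in a chart). $T^kM=\bigcup_{x\in M}C_x/\approx^k_x$, the class of $\gamma$ is $[\gamma,x]_k$, and $\pi_k:T^kM\to M$, $[\gamma,x]_k\mapsto x$. $T^kM$ carries the smooth manifold structure (modelled on $\mathbb{E}^{k+1}$), making $\pi_k$ a smooth fibre bundle, with charts $\Psi_\alpha^k:\pi_k^{-1}(U_\alpha)\to\psi_\alpha(U_\alpha)\times\mathbb{E}^k$, $[\gamma,x]_k\mapsto\big((\psi_\alpha\circ\gamma)(0),(\psi_\alpha\circ\gamma)'(0),\dots,\frac1{k!}(\psi_\alpha\circ\gamma)^{(k)}(0)\big)$.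 A vector bundle structure on $\pi_k:T^kM\to M$ is a smooth Banach vector bundle structure over $M$ on the manifold $T^kM$ with projection $\pi_k$ (compatible with the smooth manifold structure on $T^kM$ given by the charts $(\pi_k^{-1}(U_\alpha),\Psi_\alpha^k)$, $\alpha\in I$). It is isomorphic to $\oplus_{i=1}^kTM$ if it is isomorphic, as a smooth vector bundle over $M$ (covering the identity of $M$), to the Whitney sum of $k$ copies of $TM$. A linear connection on $M$ is given by local components $\Gamma_\alpha$, $\alpha\in I$: smooth maps $\psi_\alpha(U_\alpha)\to L^2(\mathbb{E},\mathbb{E};\mathbb{E})$ into the continuous bilinear maps, written $(x;\xi,y)\mapsto\Gamma_\alpha(x,\xi)y$, such that on overlaps, with $\psi_{\beta\alpha}=\psi_\beta\circ\psi_\alpha^{-1}$, $d\psi_{\beta\alpha}(x)[\Gamma_\alpha(x,\xi)y]=d^2\psi_{\beta\alpha}(x)(\xi,y)+\Gamma_\beta\big(\psi_{\beta\alpha}(x),d\psi_{\beta\alpha}(x)\xi\big)\,d\psi_{\beta\alpha}(x)y$. *)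

(* Defs.v *)
From HB Require Import structures.
From mathcomp Require Import all_boot all_order all_algebra.
From mathcomp Require Import all_classical all_reals all_analysis.

Set Implicit Arguments.
Unset Strict Implicit.
Unset Printing Implicit Defensive.
Import Order.TTheory GRing.Theory Num.Theory.
Import numFieldNormedType.Exports.

Local Open Scope classical_set_scope.
Local Open Scope ring_scope.

Section FfunNormed.
Context {R : realType} {I : finType} {E : normedModType R}.
Implicit Types f g : {ffun I -> E}.

Definition ffun_norm f : R := \big[Num.max/0]_i `|f i|.

Lemma ffun_norm_ge f i : `|f i| <= ffun_norm f.
Proof. exact: le_bigmax. Qed.

Lemma ffun_norm_le f (c : R) : 0 <= c -> (forall i, `|f i| <= c) -> ffun_norm f <= c.
Proof. by move=> c0 h; apply: bigmax_le. Qed.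

Lemma ffun_norm_ge0 f : 0 <= ffun_norm f.
Proof. exact: bigmax_ge_id. Qed.

Lemma ffun_ler_normD f g : ffun_norm (f + g) <= ffun_norm f + ffun_norm g.
Proof.
apply: ffun_norm_le => [|i]; first by rewrite addr_ge0 ?ffun_norm_ge0.
by rewrite ffunE (le_trans (ler_normD _ _))// lerD ?ffun_norm_ge.
Qed.

Lemma ffun_normrZ (l : R) f : ffun_norm (l *: f) = `|l| * ffun_norm f.
Proof.
apply/eqP; rewrite eq_le; apply/andP; split.
  apply: ffun_norm_le => [|i]; first by rewrite mulr_ge0 ?ffun_norm_ge0.
  by rewrite ffunE normrZ ler_wpM2l ?ffun_norm_ge.
have [->|l0] := eqVneq l 0; first by rewrite normr0 mul0r ffun_norm_ge0.
rewrite mulrC -ler_pdivlMr ?normr_gt0//; apply: ffun_norm_le => [|i].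
  by rewrite divr_ge0 ?ffun_norm_ge0.
rewrite ler_pdivlMr ?normr_gt0// mulrC -normrZ.
by have := ffun_norm_ge (l *: f) i; rewrite ffunE.
Qed.

Lemma ffun_normr0_eq0 f : ffun_norm f = 0 -> f = 0.
Proof.
move=> f0; apply/ffunP => i; rewrite ffunE; apply/eqP.
by rewrite -normr_le0 -f0 ffun_norm_ge.
Qed.

HB.instance Definition _ := Lmodule_isNormed.Build R {ffun I -> E}
  ffun_ler_normD ffun_normrZ ffun_normr0_eq0.

End FfunNormed.

Section FfunComplete.
Context {R : realType} {I : finType} {E : completeNormedModType R}.

Lemma ffun_complete (F : set_system {ffun I -> E}) :
  ProperFilter F -> cauchy F -> cvg F.
Proof.
move=> FF Fc.
have cvi i : cvg ((fun f : {ffun I -> E} => f i) @ F).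
  apply: cauchy_cvg; apply: cauchy_exP => e e0.
  have /cauchyP/(_ e e0)[f Ff] := Fc.
  exists (f i); suff : F [set g | ball (f i) e (g i)] by [].
  apply: filterS Ff => g /=; rewrite -!ball_normE /=.
  by apply: le_lt_trans; have := ffun_norm_ge (f - g) i; rewrite !ffunE.
pose l : {ffun I -> E} := [ffun i => lim ((fun f : {ffun I -> E} => f i) @ F)].
apply: (cvgP l); apply/cvgrPdist_lt => e e0.
have e20 : 0 < e / 2 by rewrite divr_gt0.
have : F [set f : {ffun I -> E} | forall i, `|l i - f i| < e / 2].
  apply: filter_forall => i; rewrite ffunE.
  by move/cvgrPdist_lt: (cvi i); apply.
apply: filterS => f Hf; apply: (@le_lt_trans _ _ (e / 2)); last first.
  by rewrite ltr_pdivrMr// ltr_pMr// ltr1n.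
apply: ffun_norm_le => [|i]; first exact: ltW.
by have := ltW (Hf i); rewrite !ffunE.
Qed.

HB.instance Definition _ := Uniform_isComplete.Build {ffun I -> E} ffun_complete.

End FfunComplete.

Section ContinuousLinear.
Context {R : realType} {V W : normedModType R}.

Definition clin_pred : {pred V -> W} :=
  fun f => `[< linear f /\ continuous f >].

Lemma clin_submod_closed : submod_closed clin_pred.
Proof.
split=> [|a f g]; rewrite !inE.
  split=> [b x y|x]; first by rewrite scaler0 addr0.
  exact: cvg_cst.
move=> [lf cf] [lg cg]; split=> [b x y|x].
  rewrite !fctE/= lf lg !scalerDr !scalerA (mulrC a b) -!addrA.
  by congr (_ + _); rewrite addrCA.
by apply: cvgD; [apply: cvgZl_tmp; exact: cf|exact: cg].
Qed.

HB.instance Definition _ :=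
  GRing.isSubmodClosed.Build R (V -> W) clin_pred clin_submod_closed.

End ContinuousLinear.


(* Continuous linear maps, with the operator norm. *)
Record clin {R : realType} (V W : normedModType R) := Clin {
  clin_fun :> V -> W ;
  clinP : clin_fun \in clin_pred }.

Section ClinNormed.
Context {R : realType} {V W : normedModType R}.
Implicit Types f g : clin V W.

HB.instance Definition _ := [isSub for @clin_fun R V W].
HB.instance Definition _ := [Choice of clin V W by <:].
HB.instance Definition _ := [SubChoice_isSubLmodule of clin V W by <:].

Lemma clin_lin f : linear f.
Proof. by have := clinP f; rewrite inE => -[]. Qed.

Lemma clin_cont f : continuous f.
Proof. by have := clinP f; rewrite inE => -[]. Qed.

HB.instance Definition _ f := GRing.isLinear.Build R V W _ f (clin_lin f).

Definition op_norm f : R := sup [set `|f x| | x in [set x : V | `|x| <= 1]].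

Lemma op_norm_has_sup f : has_sup [set `|f x| | x in [set x : V | `|x| <= 1]].
Proof.
split; first by exists `|f 0|; exists 0 => //=; rewrite normr0.
have /linear_boundedP/pinfty_ex_gt0[r r0 rf] : bounded_near f (nbhs (0 : V)).
  exact/linear_bounded_continuous/clin_cont.
exists r => _ [x /= x1 <-]; apply: le_trans (rf x) _.
by rewrite -[leRHS]mulr1 ler_pM2l.
Qed.

Lemma op_norm_ge0 f : 0 <= op_norm f.
Proof.
apply: le_trans (normr_ge0 (f 0)) _; apply: ub_le_sup.
  by case: (op_norm_has_sup f).
by exists 0 => //=; rewrite normr0.
Qed.

Lemma op_normP f x : `|f x| <= op_norm f * `|x|.
Proof.
have [->|x0] := eqVneq x 0; first by rewrite linear0 !normr0 mulr0.
have nx : 0 < `|x| by rewrite normr_gt0.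
rewrite -ler_pdivrMr// mulrC -[X in X * _]ger0_norm ?invr_ge0// -normrZ -linearZ.
apply: ub_le_sup; first by case: (op_norm_has_sup f).
exists (`|x|^-1 *: x) => //=.
by rewrite normrZ ger0_norm ?invr_ge0// mulVf// gt_eqF.
Qed.

Lemma op_norm_le f (c : R) : 0 <= c -> (forall x, `|f x| <= c * `|x|) ->
  op_norm f <= c.
Proof.
move=> c0 h; apply: ge_sup; first by case: (op_norm_has_sup f).
move=> _ [x /= x1 <-]; apply: le_trans (h x) _.
by rewrite -[leRHS]mulr1 ler_wpM2l.
Qed.

Lemma op_ler_normD f g : op_norm (f + g) <= op_norm f + op_norm g.
Proof.
apply: op_norm_le => [|x]; first by rewrite addr_ge0 ?op_norm_ge0.
by rewrite mulrDl (le_trans (ler_normD _ _))// lerD ?op_normP.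
Qed.

Lemma op_normrZ_le (l : R) f : op_norm (l *: f) <= `|l| * op_norm f.
Proof.
apply: op_norm_le => [|x]; first by rewrite mulr_ge0 ?op_norm_ge0.
by rewrite [_ x](_ : _ = l *: f x)// normrZ -mulrA ler_wpM2l// op_normP.
Qed.

Lemma op_normrZ (l : R) f : op_norm (l *: f) = `|l| * op_norm f.
Proof.
apply/eqP; rewrite eq_le op_normrZ_le/=.
have [->|l0] := eqVneq l 0; first by rewrite normr0 mul0r op_norm_ge0.
rewrite -{1}[f](scalerK l0) (le_trans (ler_wpM2l _ (op_normrZ_le _ _)))//.
by rewrite mulrA -normrM mulfV// normr1 mul1r.
Qed.

Lemma op_normr0_eq0 f : op_norm f = 0 -> f = 0.
Proof.
move=> f0; apply/val_inj/funext => x /=; apply/eqP.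
by rewrite -normr_le0 (le_trans (op_normP f x))// f0 mul0r.
Qed.

HB.instance Definition _ := Lmodule_isNormed.Build R (clin V W)
  op_ler_normD op_normrZ op_normr0_eq0.

End ClinNormed.

Section Smooth.
Context {R : realType}.

(* The Frechet derivative as an element of [clin V W]; the value is 0 where f is
   not differentiable. *)
Definition fderiv {V W : normedModType R} (f : V -> W) (x : V) : clin V W :=
  xget 0 [set l : clin V W | differentiable f x /\ l = 'd f x :> (V -> W)].

Lemma fderivE {V W : normedModType R} (f : V -> W) (x : V) :
  differentiable f x -> fderiv f x = 'd f x :> (V -> W).
Proof.
move=> df; have dP : ('d f x : V -> W) \in clin_pred.
  by rewrite inE; split; [exact: linearP|exact: diff_continuous].
by rewrite /fderiv; case: xgetP => [l _ []//|/(_ (Clin dP))[]].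
Qed.

Fixpoint Cn (n : nat) {V W : normedModType R} (S : set V) (f : V -> W) : Prop :=
  if n is m.+1 then
    (forall x, S x -> differentiable f x) /\ Cn m S (fderiv f)
  else {in S, continuous f}.

Definition Cinfty {V W : normedModType R} (S : set V) (f : V -> W) : Prop :=
  forall n, Cn n S f.

End Smooth.

Section Manifold.
Context {R : realType}.

(* Charts are total functions, meaningful on their domain only. *)
Record atlas (E : normedModType R) (X : Type) := Atlas {
  aidx : Type ;
  adom : aidx -> set X ;
  achart : aidx -> X -> E }.

Definition id_atlas (V : normedModType R) : atlas V V :=
  Atlas (fun _ : unit => setT) (fun _ => idfun).

(* [chart b \o f \o (chart a)^-1], defined where this composition makes sense,
   and 0 elsewhere. *)
Definition local_rep {E F : normedModType R} {X Y : Type}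
    (AX : atlas E X) (AY : atlas F Y) (f : X -> Y) (a : aidx AX) (b : aidx AY)
    (e : E) : F :=
  xget 0 [set y | exists x, [/\ adom a x, adom b (f x),
                                achart a x = e & achart b (f x) = y]].

(* [f] is smooth on S; as the images of the domains are required to be open, this
   includes the openness of S and the continuity of f on S. *)
Definition smooth_on {E F : normedModType R} {X Y : Type}
    (AX : atlas E X) (AY : atlas F Y) (S : set X) (f : X -> Y) : Prop :=
  forall (a : aidx AX) (b : aidx AY),
    let O := achart a @` (S `&` adom a `&` f @^-1` adom b) in
    open O /\ Cinfty O (local_rep f a b).

Definition compatible {E F : normedModType R} {X : Type}
    (A : atlas E X) (B : atlas F X) : Prop :=
  smooth_on A B setT idfun /\ smooth_on B A setT idfun.

Definition trans {E : normedModType R} {X : Type} (A : atlas E X)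
  (a b : aidx A) : E -> E := local_rep idfun a b.

Record smooth_manifold {E : normedModType R} {M : topologicalType}
    (A : atlas E M) : Prop := {
  adom_cover : forall x, exists a : aidx A, adom a x ;
  adom_open : forall a : aidx A, open (adom a) ;
  achart_inj : forall a : aidx A, set_inj (adom a) (achart a) ;
  achart_continuous : forall a : aidx A, {in adom a, continuous (achart a)} ;
  achart_open : forall (a : aidx A) (O : set M),
    open O -> open (achart a @` (O `&` adom a)) ;
  trans_smooth : forall a b : aidx A,
    Cinfty (achart a @` (adom a `&` adom b)) (trans a b) }.

Definition partitionable {E : normedModType R} {M : topologicalType}
    (A : atlas E M) : Prop :=
  forall C : set (set M),
    (forall U, C U -> open U) -> (forall x, exists2 U, C U & U x) ->
  exists rho : set M -> M -> R,
    [/\ forall U, C U -> smooth_on A (id_atlas R) setT (rho U),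
        forall U x, C U -> 0 <= rho U x,
        forall U, C U -> closure [set x | rho U x != 0] `<=` U,
        forall x : M, exists2 N, nbhs x N &
          finite_set [set U | C U /\ N `&` [set y | rho U y != 0] !=set0] &
        forall x, \sum_(U \in C) rho U x = 1].

End Manifold.

Section Jets.
Context {R : realType} {E : normedModType R} {M : topologicalType}.
Variables (A : atlas E M) (k : nat).

(* Curves are total functions, meaningful near 0 only. *)
Definition smooth_curve (g : R -> M) : Prop :=
  exists2 e : R, 0 < e & smooth_on (id_atlas R) A `](- e), e[%classic g.

Definition jet_eq (g1 g2 : R -> M) : Prop :=
  g1 0 = g2 0 /\
  exists2 a : aidx A, adom a (g1 0) &
    forall j, (1 <= j <= k)%N ->
      derive1n j (achart a \o g1) 0 = derive1n j (achart a \o g2) 0.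

Definition jet_class (g : R -> M) : set (R -> M) :=
  [set h | smooth_curve h /\ jet_eq g h].

(* T^k M, as the set of equivalence classes. *)
Definition jet : Type :=
  {c : set (R -> M) | exists2 g, smooth_curve g & c = jet_class g}.

Definition jet_repr (t : jet) : R -> M := s2val (cid2 (svalP t)).

Definition jet_proj (t : jet) : M := jet_repr t 0.

Definition jet_atlas : atlas (E * {ffun 'I_k -> E})%type jet :=
  Atlas (fun a : aidx A => jet_proj @^-1` adom a)
    (fun a t => (achart a (jet_repr t 0),
      [ffun j : 'I_k => (j.+1`!%:R)^-1 *: derive1n j.+1 (achart a \o jet_repr t) 0])).

End Jets.

Arguments jet_proj {R E M} A k t.

Section VectorBundles.
Context {R : realType} {E : normedModType R} {M : topologicalType}.
Variable A : atlas E M.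

(* A trivialising covering of [pr : X -> M] with fibre [F]: over [tdom i], the
   trivialisation is [z |-> (pr z, ttriv i z)]. *)
Record triv_cover (F : normedModType R) (X : Type) := TrivCover {
  tidx : Type ;
  tdom : tidx -> set M ;
  ttriv : tidx -> X -> F }.

(* The manifold structure on X defined by a trivialising covering. *)
Definition total_atlas {F : normedModType R} {X : Type} (pr : X -> M)
    (T : triv_cover F X) : atlas (E * F)%type X :=
  Atlas (fun ai : aidx A * tidx T => pr @^-1` (adom ai.1 `&` tdom ai.2))
    (fun ai z => (achart ai.1 (pr z), ttriv ai.2 z)).

(* The linear structure on the fibres is the one transported by the
   trivialisations; the last condition makes it independent of them. *)
Record vector_bundle {F : normedModType R} {X : Type} (pr : X -> M)
    (T : triv_cover F X) : Prop := {
  tdom_cover : forall x, exists i : tidx T, tdom i x ;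
  tdom_open : forall i : tidx T, open (tdom i) ;
  ttriv_bij : forall i : tidx T,
    set_bij (pr @^-1` tdom i) (tdom i `*` setT) (fun z => (pr z, ttriv i z)) ;
  ttriv_trans : forall i j : tidx T, exists2 g : M -> clin F F,
    smooth_on A (id_atlas (clin F F)) (tdom i `&` tdom j) g &
    forall z, tdom i (pr z) -> tdom j (pr z) ->
      ttriv j z = g (pr z) (ttriv i z) }.

(* Morphisms covering the identity of M. *)
Record vb_morphism {F F' : normedModType R} {X X' : Type}
    (pr : X -> M) (T : triv_cover F X) (pr' : X' -> M) (T' : triv_cover F' X')
    (f : X -> X') : Prop := {
  vb_smooth : smooth_on (total_atlas pr T) (total_atlas pr' T') setT f ;
  vb_over : forall z, pr' (f z) = pr z ;
  vb_local : forall (i : tidx T) (j : tidx T'), exists2 g : M -> clin F F',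
    smooth_on A (id_atlas (clin F F')) (tdom i `&` tdom j) g &
    forall z, tdom i (pr z) -> tdom j (pr z) ->
      ttriv j (f z) = g (pr z) (ttriv i z) }.

Definition vb_isomorphic {F F' : normedModType R} {X X' : Type}
    (pr : X -> M) (T : triv_cover F X)
    (pr' : X' -> M) (T' : triv_cover F' X') : Prop :=
  exists (f : X -> X') (g : X' -> X),
    [/\ cancel f g, cancel g f,
        vb_morphism pr T pr' T' f & vb_morphism pr' T' pr T g].

(* Whitney sum of k copies of a bundle. *)
Definition whitney (k : nat) {X : Type} (pr : X -> M) : Type :=
  {p : M * ('I_k -> X) | forall i, pr (p.2 i) = p.1}.

Definition whitney_proj {k : nat} {X : Type} {pr : X -> M}
  (w : whitney k pr) : M := (sval w).1.

Definition whitney_cover (k : nat) {F : normedModType R} {X : Type}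
    (pr : X -> M) (T : triv_cover F X) :
    triv_cover {ffun 'I_k -> F} (whitney k pr) :=
  TrivCover (fun i : tidx T => tdom i)
    (fun i w => [ffun l => ttriv i ((sval w).2 l)]).

Definition tangent : Type := jet A 1.

Definition tangent_proj : tangent -> M := jet_proj A 1.

Definition tangent_cover : triv_cover E tangent :=
  TrivCover (fun a : aidx A => adom a)
    (fun a t => (achart (a := jet_atlas A 1) a t).2 ord0).

(* [pi_k : T^k M -> M] admits a vector bundle structure isomorphic to the Whitney
   sum of k copies of TM. *)
Definition jet_bundle_splits (k : nat) : Prop :=
  exists (F : completeNormedModType R) (T : triv_cover F (jet A k)),
    [/\ vector_bundle (jet_proj A k) T,
        compatible (total_atlas (jet_proj A k) T) (jet_atlas A k) &
        vb_isomorphic (jet_proj A k) T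
          (@whitney_proj k _ tangent_proj) (whitney_cover k tangent_proj tangent_cover)].

(* L^2(E, E; E) is [clin E (clin E E)]. *)
Definition linear_connection
    (Gamma : aidx A -> E -> clin E (clin E E)) : Prop :=
  (forall a, Cinfty (achart a @` adom a) (Gamma a)) /\
  forall (a b : aidx A) (x xi y : E), (achart a @` (adom a `&` adom b)) x ->
    let psi := trans a b in
    let dpsi := fderiv psi x in
    let d2psi := fderiv (fderiv psi) x in
    dpsi (Gamma a x xi y) = d2psi xi y + Gamma b (psi x) (dpsi xi) (dpsi y).

End VectorBundles.

(* Main.v *)
Require Import Defs.
From HB Require Import structures.
From mathcomp Require Import all_boot all_order all_algebra.
From mathcomp Require Import all_classical all_reals all_analysis.

Set Implicit Arguments.
Unset Strict Implicit.
Unset Printing Implicit Defensive.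
Import Order.TTheory GRing.Theory Num.Theory.
Import numFieldNormedType.Exports.

Local Open Scope ring_scope.
Local Open Scope classical_set_scope.

(** A linear connection differentiates a vector field [v] along a curve [c]: in
    a chart the covariant derivative is [v' + Gamma(c)(c', v)].  Iterating it
    from the velocity [c'] produces the vectors [cov 0], [cov 1], ..., and the
    transformation law of [Gamma] says precisely that under a change of charts
    [psi] each of them is multiplied by the derivative of [psi], as a tangent
    vector is ([cov_change]).

    In a chart [cov j] is the derivative of order [j + 1] of [c] plus a smooth
    function of the derivatives of lower order ([cov_jet]).  Hence
    [(c(0), cov 0 (0), ..., cov (k - 1) (0))] is another smooth system of
    coordinates on jets of order [k]: the passage from the Taylor coefficients
    is triangular, and is inverted by successive substitution
    ([frame_of_jetK], [jet_of_frameK]).  As these coordinates change linearly,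
    they also show that equality of jets does not depend on the chart, with no
    formula for higher derivatives of a composition ([jet_eq_frame]).

    In frame coordinates T^k M is thus a vector bundle whose transition maps act
    on each of the [k] components by the derivative of the change of charts.
    The Whitney sum of [k] copies of TM has the same transition maps, and two
    bundles with the same transition maps over the same cover are isomorphic
    ([same_cocycle_isomorphic]).  So a connection splits T^k M for every [k]
    ([connection_jet_bundle_splits]).

    For the converse and for the second part, a partition of unity produces a
    connection ([partitionable_connection]).  The domain of each chart carries
    the flat connection whose components in that chart vanish; its components
    in the other charts are second derivatives of changes of charts.  The
    transformation law is affine in [Gamma], so a weighted mean of flat
    connections, with weights of sum one, is again a connection. *)

(** * Continuous linear and bilinear maps *)

Section ContinuousLinearMaps.
Context {R : realType}.
Implicit Types U V W X : normedModType R.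

Lemma clin_predI V W (f : V -> W) (k : R) :
  linear f -> (forall x, `|f x| <= k * `|x|) -> f \in clin_pred.
Proof.
move=> lf fk; rewrite inE; split=> //.
pose fL : {linear V -> W} :=
  HB.pack f (GRing.isLinear.Build _ _ _ _ _ lf).
rewrite -[f]/(fL : V -> W); apply/linear_bounded_continuous.
apply/linear_boundedP; apply: filterS (nbhs_pinfty_ge (num_real k)) => r kr x.
by rewrite (le_trans (fk x))// ler_wpM2r.
Qed.

Definition mk_clin V W (f : V -> W) (k : R) (lf : linear f)
    (fk : forall x, `|f x| <= k * `|x|) : clin V W :=
  Clin (clin_predI lf fk).

Lemma clinD V W (f g : clin V W) x : (f + g) x = f x + g x.
Proof. by []. Qed.
Lemma clinZ V W a (f : clin V W) x : (a *: f) x = a *: f x.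
Proof. by []. Qed.
Lemma clin_ext V W (f g : clin V W) : f =1 g -> f = g.
Proof. by move=> fg; apply/val_inj/funext. Qed.

Lemma clin_funD V W (f : clin V W) x y : f (x + y) = f x + f y.
Proof. exact: linearD. Qed.
Lemma clin_funZ V W (f : clin V W) a x : f (a *: x) = a *: f x.
Proof. exact: linearZ. Qed.
Lemma clin_fun0 V W (f : clin V W) : f 0 = 0.
Proof. exact: linear0. Qed.

Lemma mk_bilin_lin U V W (B : U -> V -> W) (k : R)
  (l1 : forall v, linear (B ^~ v)) (l2 : forall u, linear (B u))
  (bB : forall u v, `|B u v| <= k * `|u| * `|v|) :
  linear (fun u => mk_clin (l2 u) (bB u)).
Proof. by move=> a u u'; apply: clin_ext => v /=; rewrite l1. Qed.

Lemma mk_bilin_bound U V W (B : U -> V -> W) (k : R) (k0 : 0 <= k)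
  (l2 : forall u, linear (B u))
  (bB : forall u v, `|B u v| <= k * `|u| * `|v|) u :
  `|mk_clin (l2 u) (bB u)| <= k * `|u|.
Proof. by apply: op_norm_le => [|v]; [rewrite mulr_ge0|apply: bB]. Qed.

(** The space [clin U (clin V W)] plays the role of the continuous bilinear maps
    on [U] and [V]; a bound [k * |u| * |v|] is what makes the curried map
    continuous for the operator norm. *)
Definition mk_bilin U V W (B : U -> V -> W) (k : R) (k0 : 0 <= k)
  (l1 : forall v, linear (B ^~ v)) (l2 : forall u, linear (B u))
  (bB : forall u v, `|B u v| <= k * `|u| * `|v|) : clin U (clin V W) :=
  mk_clin (mk_bilin_lin l1 l2 bB) (mk_bilin_bound k0 l2 bB).

Lemma clin_norm V W (f : clin V W) x : `|f x| <= `|f| * `|x|.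
Proof. exact: op_normP. Qed.

Lemma bilin_norm U V W (B : clin U (clin V W)) u v :
  `|B u v| <= `|B| * `|u| * `|v|.
Proof.
by apply: le_trans (clin_norm _ _) _; rewrite ler_wpM2r// clin_norm.
Qed.

Fact compL_bound U V W (g : clin V W) (f : clin U V) x :
  `|g (f x)| <= (`|g| * `|f|) * `|x|.
Proof.
by rewrite -mulrA (le_trans (clin_norm _ _))// ler_wpM2l// clin_norm.
Qed.

Fact compL_linear U V W (g : clin V W) (f : clin U V) : linear (g \o f).
Proof. by move=> a x y /=; rewrite !linearP. Qed.

Definition compL U V W (g : clin V W) (f : clin U V) : clin U W :=
  mk_clin (compL_linear g f) (compL_bound g f).

Lemma compLE U V W (g : clin V W) (f : clin U V) x : compL g f x = g (f x).
Proof. by []. Qed.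

Fact compB_bound U V W (g : clin V W) (f : clin U V) :
  `|compL g f| <= 1 * `|g| * `|f|.
Proof.
apply: op_norm_le => [|x]; first by rewrite mul1r mulr_ge0.
by rewrite mul1r compL_bound.
Qed.

Fact compB_lin1 U V W (f : clin U V) : linear (fun g : clin V W => compL g f).
Proof. by move=> a g g'; apply: clin_ext. Qed.

Fact compB_lin2 U V W (g : clin V W) : linear (compL g : clin U V -> clin U W).
Proof. by move=> a f f'; apply: clin_ext => x /=; rewrite linearP. Qed.

Definition compB U V W : clin (clin V W) (clin (clin U V) (clin U W)) :=
  mk_bilin ler01 (@compB_lin1 U V W) (@compB_lin2 U V W) (@compB_bound U V W).

Fact flip_lin1 U V W (B : clin U (clin V W)) u : linear (fun v => B u v).
Proof. by move=> a x y; rewrite linearP. Qed.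
Fact flip_lin2 U V W (B : clin U (clin V W)) v : linear (fun u => B u v).
Proof. by move=> a x y; rewrite linearP. Qed.
Fact flip_bound U V W (B : clin U (clin V W)) v u : `|B u v| <= `|B| * `|v| * `|u|.
Proof. by rewrite mulrAC bilin_norm. Qed.

Definition flipL U V W (B : clin U (clin V W)) : clin V (clin U W) :=
  mk_bilin (normr_ge0 B) (flip_lin1 B) (flip_lin2 B) (flip_bound B).

Fact id_linear V : linear (idfun : V -> V). Proof. by []. Qed.
Fact id_bound V (x : V) : `|x| <= 1 * `|x|. Proof. by rewrite mul1r. Qed.
Definition idL V : clin V V := mk_clin (@id_linear V) (@id_bound V).

Fact fst_linear V W : linear (fst : V * W -> V). Proof. by []. Qed.
Fact fst_bound V W (x : V * W) : `|x.1| <= 1 * `|x|.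
Proof. by rewrite mul1r prod_normE le_max lexx. Qed.
Definition fstL V W : clin (V * W)%type V := mk_clin (@fst_linear V W) (@fst_bound V W).

Fact snd_linear V W : linear (snd : V * W -> W). Proof. by []. Qed.
Fact snd_bound V W (x : V * W) : `|x.2| <= 1 * `|x|.
Proof. by rewrite mul1r prod_normE le_max lexx orbT. Qed.
Definition sndL V W : clin (V * W)%type W := mk_clin (@snd_linear V W) (@snd_bound V W).

Fact inl_linear V W : linear (fun x : V => (x, 0) : V * W).
Proof. by move=> a x y; congr pair; rewrite /= scaler0 addr0. Qed.
Fact inl_bound V W (x : V) : `|(x, 0) : V * W| <= 1 * `|x|.
Proof. by rewrite mul1r prod_normE /= normr0 ge_max lexx normr_ge0. Qed.
Definition inlL V W : clin V (V * W)%type := mk_clin (@inl_linear V W) (@inl_bound V W).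

Fact inr_linear V W : linear (fun y : W => (0, y) : V * W).
Proof. by move=> a x y; congr pair; rewrite /= scaler0 addr0. Qed.
Fact inr_bound V W (x : W) : `|(0, x) : V * W| <= 1 * `|x|.
Proof. by rewrite mul1r prod_normE /= normr0 ge_max lexx normr_ge0. Qed.
Definition inrL V W : clin W (V * W)%type := mk_clin (@inr_linear V W) (@inr_bound V W).

Fact ffun_at_linear (I : finType) V (i : I) : linear (fun f : {ffun I -> V} => f i).
Proof. by move=> a f g; rewrite !ffunE. Qed.
Fact ffun_at_bound (I : finType) V (i : I) (f : {ffun I -> V}) : `|f i| <= 1 * `|f|.
Proof. by rewrite mul1r; apply: ffun_norm_ge. Qed.
Definition ffun_atL (I : finType) V (i : I) : clin {ffun I -> V} V :=
  mk_clin (@ffun_at_linear I V i) (@ffun_at_bound I V i).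

Fact ffun_in_linear (I : finType) V (i : I) :
  linear (fun v : V => [ffun j => if j == i then v else 0] : {ffun I -> V}).
Proof.
move=> a f g; apply/ffunP => j; rewrite !ffunE.
by case: ifP => //; rewrite scaler0 addr0.
Qed.
Fact ffun_in_bound (I : finType) V (i : I) (v : V) :
  `|[ffun j => if j == i then v else 0] : {ffun I -> V}| <= 1 * `|v|.
Proof.
rewrite mul1r; apply: ffun_norm_le => // j; rewrite ffunE.
by case: ifP => // _; rewrite normr0.
Qed.
Definition ffun_inL (I : finType) V (i : I) : clin V {ffun I -> V} :=
  mk_clin (@ffun_in_linear I V i) (@ffun_in_bound I V i).

Fact scale_linear1 V (v : V) : linear (fun r : R => r *: v).
Proof. by move=> a r s; rewrite scalerDl scalerA. Qed.
Fact scale_linear2 V (r : R) : linear (fun v : V => r *: v).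
Proof. by move=> a u v; rewrite scalerDr !scalerA mulrC. Qed.
Fact scale_bound V (r : R) (v : V) : `|r *: v| <= 1 * `|r| * `|v|.
Proof. by rewrite mul1r normrZ. Qed.
Definition scaleB V : clin R (clin V V) :=
  mk_bilin ler01 (@scale_linear1 V) (@scale_linear2 V) (@scale_bound V).

End ContinuousLinearMaps.

(** * The Frechet derivative *)

Section FrechetDerivative.
Context {R : realType}.
Implicit Types U V W X : normedModType R.

(** As [fderiv] has the value 0 where there is no derivative, an equation about
    [fderiv] is informative only together with differentiability. *)
Definition has_fderiv V W (f : V -> W) (x : V) (l : clin V W) :=
  differentiable f x /\ fderiv f x = l.

Lemma has_fderiv_fderiv V W (f : V -> W) x :
  differentiable f x -> has_fderiv f x (fderiv f x).
Proof. by []. Qed.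

Lemma has_fderivI V W (f : V -> W) x (l : clin V W) :
  differentiable f x -> 'd f x = l :> (V -> W) -> has_fderiv f x l.
Proof.
by move=> df dl; split => //; apply: clin_ext => h; rewrite fderivE// dl.
Qed.

(** The epsilon form makes it plain that the derivative depends on the germ of
    the function only, and gives the derivative of a bilinear map directly. *)
Lemma has_fderivP V W (f : V -> W) x (l : clin V W) :
  has_fderiv f x l <->
  forall e, 0 < e -> \forall h \near 0, `|f (h + x) - f x - l h| <= e * `|h|.
Proof.
have -> : (forall e, 0 < e -> \forall h \near 0, `|f (h + x) - f x - l h| <= e * `|h|)
   <-> f \o shift x = cst (f x) + l +o_ 0 id.
  split=> [H|/eqaddoP H].
    apply/eqaddoP => e e0; have := H e e0; apply: filterS => h /=.
    by rewrite -[(_ - _) h]/(f (h + x) - (f x + l h)) opprD addrA.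
  move=> e e0; have := H e e0; apply: filterS => h /=.
  by rewrite -[(_ - _) h]/(f (h + x) - (f x + l h)) opprD addrA.
split=> [[df <-]|H].
  by rewrite fderivE//; apply: diff_locally.
have E := diff_unique (@clin_cont _ _ _ l) H.
apply: has_fderivI => //; apply/diff_locallyP; split.
  by rewrite E; apply: clin_cont.
by rewrite E.
Qed.

Lemma has_fderiv_near V W (f g : V -> W) x l :
  {near x, f =1 g} -> has_fderiv f x l -> has_fderiv g x l.
Proof.
move=> fg /has_fderivP H; apply/has_fderivP => e e0.
have := H e e0; apply: filterS2 (_ : \forall h \near 0, f (h + x) = g (h + x)).
  by move=> h <-; rewrite (nbhs_singleton fg).
by have := fg; rewrite (near_shift 0 x); apply: filterS => h /=; rewrite subr0.
Qed.

Lemma fderiv_near V W (f g : V -> W) x :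
  {near x, f =1 g} -> differentiable f x -> fderiv g x = fderiv f x.
Proof. by move=> fg /has_fderiv_fderiv/(has_fderiv_near fg)[]. Qed.

Lemma has_fderiv_cst V W (c : W) (x : V) : has_fderiv (fun=> c) x 0.
Proof.
apply: has_fderivI; first exact: differentiable_cst.
by rewrite -[X in 'd X x]/(cst c) diff_cst.
Qed.

Lemma has_fderiv_clin V W (l : clin V W) (x : V) : has_fderiv l x l.
Proof.
apply: has_fderivI; first exact/linear_differentiable/clin_cont.
exact/diff_lin/clin_cont.
Qed.

Lemma has_fderivD V W (f g : V -> W) x a b :
  has_fderiv f x a -> has_fderiv g x b ->
  has_fderiv (fun y => f y + g y) x (a + b).
Proof.
move=> [df <-] [dg <-]; apply: has_fderivI; first exact: differentiableD.
by rewrite -[X in 'd X x]/(f + g) diffD// -!fderivE.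
Qed.

Lemma has_fderiv_comp U V W (f : U -> V) (g : V -> W) x a b :
  has_fderiv f x a -> has_fderiv g (f x) b ->
  has_fderiv (fun y => g (f y)) x (compL b a).
Proof.
move=> [df <-] [dg <-]; apply: has_fderivI; first exact: differentiable_comp.
by rewrite -[X in 'd X x]/(g \o f) diff_comp// -!fderivE.
Qed.

Lemma has_fderiv_pair U V W (f : U -> V) (g : U -> W) x a b :
  has_fderiv f x a -> has_fderiv g x b ->
  has_fderiv (fun y => (f y, g y)) x (compL (inlL V W) a + compL (inrL V W) b).
Proof.
move=> [df <-] [dg <-]; apply: has_fderivI; first exact: differentiable_pair.
rewrite diff_pair// -!fderivE//; apply/funext => h.
by rewrite clinD /= -[RHS]/(_ + 0, 0 + _) addr0 add0r.
Qed.

Lemma has_fderiv_bilin0 U V W (B : clin U (clin V W)) (p : U * V) :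
  has_fderiv (fun q : U * V => B q.1 q.2) p
    (compL (flipL B p.2) (fstL U V) + compL (B p.1) (sndL U V)).
Proof.
apply/has_fderivP => e e0.
(* the increment of [|B|] by one guards against [B = 0] in the division below *)
have B0 : 0 < `|B| + 1 by rewrite ltr_wpDl.
near=> h.
have -> : B (h + p).1 (h + p).2 - B p.1 p.2 - ((compL (flipL B p.2) (fstL U V) +
    compL (B p.1) (sndL U V)) h) = B h.1 h.2.
  rewrite clinD /= !(clin_funD, clinD) (addrA (B h.1 h.2 + _)) addrK.
  by rewrite -(addrA (B h.1 h.2)) (addrC (B p.1 h.2)) addrK.
apply: le_trans (bilin_norm _ _ _) _.
have h1 : `|h.1| <= `|h| by rewrite [leRHS]prod_normE le_max lexx.
have h2 : `|h.2| <= `|h| by rewrite [leRHS]prod_normE le_max lexx orbT.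
rewrite ler_pM ?mulr_ge0//.
apply: (@le_trans _ _ ((`|B| + 1) * `|h|)); first by rewrite ler_pM// lerDl.
rewrite -ler_pdivlMl// mulrC.
near: h; exact: (@nbhs0_le _ (U * V)%type _ (divr_gt0 e0 B0)).
Unshelve. all: by end_near. Qed.

Lemma has_fderiv_bilin U V W X (B : clin U (clin V W)) (f : X -> U) (g : X -> V)
    x a b : has_fderiv f x a -> has_fderiv g x b ->
  has_fderiv (fun y => B (f y) (g y)) x
    (compL (flipL B (g x)) a + compL (B (f x)) b).
Proof.
move=> fa gb.
have := has_fderiv_comp (has_fderiv_pair fa gb) (has_fderiv_bilin0 B (f x, g x)).
congr has_fderiv; apply: clin_ext => h.
rewrite compLE !clinD !compLE; have -> : inlL U V (a h) + inrL U V (b h) = (a h, b h).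
  by rewrite /= -[LHS]/(_ + 0, 0 + _) addr0 add0r.
by [].
Qed.

End FrechetDerivative.

(** * Smooth maps between normed spaces *)

Section Smooth.
Context {R : realType}.
Implicit Types (n : nat) (U V W X : normedModType R).

Lemma Cn_continuous n V W (S : set V) (f : V -> W) : Cn n S f -> {in S, continuous f}.
Proof.
case: n => [//|n] [df _] x; rewrite inE => /df; exact: differentiable_continuous.
Qed.

Lemma Cn_sub n V W (S S' : set V) (f : V -> W) : S' `<=` S -> Cn n S f -> Cn n S' f.
Proof.
move=> SS; elim: n => [|n IH] in W f *.
  by move=> Cf x; rewrite inE => /SS Sx; apply: Cf; rewrite inE.
by move=> [df Cf]; split=> [x /SS/df//|]; apply: IH.
Qed.

Lemma Cn_pred n V W (S : set V) (f : V -> W) : Cn n.+1 S f -> Cn n S f.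
Proof.
elim: n => [|n IH] in W f *; first exact: Cn_continuous.
by move=> [df Cf]; split=> //; apply: IH.
Qed.

(** The conditions in [Cn] bear on one point at a time, so smoothness may be
    checked on a set around each point, which can vary with the point. *)
Lemma Cn_local n V W (S : set V) (f : V -> W) :
  (forall x, S x -> exists2 N : set V, N x & Cn n N f) -> Cn n S f.
Proof.
elim: n => [|n IH] in W f *.
  by move=> H x; rewrite inE => /H[N Nx]; apply; rewrite inE.
move=> H; split=> [x /H[N Nx] [+ _]|]; first exact.
by apply: IH => x /H[N Nx] [_ CN]; exists N.
Qed.

Lemma open_near_eq V W (S : set V) (f g : V -> W) x :
  open S -> (forall y, S y -> f y = g y) -> S x -> {near x, f =1 g}.
Proof. by move=> oS fg Sx; apply: filterS fg _; apply: open_nbhs_nbhs. Qed.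

Lemma Cn_eq n V W (S : set V) (f g : V -> W) : open S ->
  (forall x, S x -> f x = g x) -> Cn n S f -> Cn n S g.
Proof.
move=> oS; elim: n => [|n IH] in W f g *.
  move=> fg Cf x; rewrite inE => Sx; rewrite /continuous_at -fg//.
  apply: cvg_trans (Cf x _); last by rewrite inE.
  apply: near_eq_cvg; exact: open_near_eq Sx.
move=> fg [df Cf]; split=> [x Sx|].
  by have [] := has_fderiv_near (open_near_eq oS fg Sx) (has_fderiv_fderiv (df _ Sx)).
apply: IH Cf => x Sx; apply/esym/fderiv_near; last exact: df.
exact: open_near_eq Sx.
Qed.

(** On an open set [fderiv f] may be replaced by any formula that computes it. *)
Lemma CnS n V W (S : set V) (f : V -> W) (f' : V -> clin V W) : open S ->
  (forall x, S x -> has_fderiv f x (f' x)) -> Cn n S f' -> Cn n.+1 S f.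
Proof.
move=> oS ff' Cf; split=> [x /ff'[]//|].
by apply: Cn_eq Cf => // x /ff'[].
Qed.

Lemma Cn_cst n V W (S : set V) (c : W) : open S -> Cn n S (fun=> c).
Proof.
move=> oS; elim: n => [|n IH] in W c *; first by move=> x _; exact: cvg_cst.
by apply: CnS (IH _ 0) => // x _; apply: has_fderiv_cst.
Qed.

Lemma Cn_clin n V W (S : set V) (l : clin V W) : open S -> Cn n S l.
Proof.
move=> oS; case: n => [|n]; first by move=> x _; apply: clin_cont.
by apply: CnS (Cn_cst _ _ oS) => // x _; apply: has_fderiv_clin.
Qed.

Lemma CnD n V W (S : set V) (f g : V -> W) : open S ->
  Cn n S f -> Cn n S g -> Cn n S (fun x => f x + g x).
Proof.
move=> oS; elim: n => [|n IH] in W f g *.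
  by move=> Cf Cg x Sx; apply: cvgD; [exact: Cf|exact: Cg].
move=> [df Cf] [dg Cg]; apply: CnS (IH _ _ _ Cf Cg) => // x Sx.
by apply: has_fderivD; apply: has_fderiv_fderiv; [exact: df|exact: dg].
Qed.

Lemma bilin_continuous U V W (B : clin U (clin V W)) :
  continuous (fun q : U * V => B q.1 q.2).
Proof.
by move=> p; apply: differentiable_continuous; have [] := has_fderiv_bilin0 B p.
Qed.

(** By the Leibniz rule the derivative is a sum of two terms that are again
    bilinear in maps of class [C^n], through composition of linear maps; hence
    the induction quantifies over the bilinear map and all spaces. *)
Lemma Cn_bilin n U V W X (S : set X) (B : clin U (clin V W))
    (f : X -> U) (g : X -> V) : open S ->
  Cn n S f -> Cn n S g -> Cn n S (fun x => B (f x) (g x)).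
Proof.
move=> oS; elim: n => [|n IH] in U V W B f g *.
  move=> Cf Cg x Sx.
  apply: (@continuous_comp _ _ _ (fun y => (f y, g y)) (fun q => B q.1 q.2)).
    by apply: cvg_pair; [exact: Cf|exact: Cg].
  exact: bilin_continuous.
move=> Cf Cg; have [df C'f] := Cf; have [dg C'g] := Cg.
apply: (@CnS _ _ _ _ _ (fun x => compL (flipL B (g x)) (fderiv f x) +
                                 compL (B (f x)) (fderiv g x))) => //.
  move=> x Sx; apply: has_fderiv_bilin; apply: has_fderiv_fderiv.
    exact: df.
  exact: dg.
apply: CnD => //.
  exact: (IH _ _ _ (compL (compB _ _ _) (flipL B)) _ _ (Cn_pred Cg) C'f).
exact: (IH _ _ _ (compL (compB _ _ _) B) _ _ (Cn_pred Cf) C'g).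
Qed.

(** The derivative of a composition is a bilinear expression, the composite of
    two linear maps, in [fderiv g \o f] and [fderiv f]. *)
Lemma Cn_comp n U V W (S : set U) (T : set V) (f : U -> V) (g : V -> W) :
  open S -> (forall x, S x -> T (f x)) -> Cn n S f -> Cn n T g ->
  Cn n S (fun x => g (f x)).
Proof.
move=> oS ST; elim: n => [|n IH] in W f g ST *.
  move=> Cf Cg x; rewrite inE => Sx.
  apply: (@continuous_comp _ _ _ f g).
    by apply: Cf; rewrite inE.
  by apply: Cg; rewrite inE; apply: ST.
move=> Cf [dg Cg]; have [df C'f] := Cf.
apply: (@CnS _ _ _ _ _ (fun x => compL (fderiv g (f x)) (fderiv f x))) => //.
  by move=> x Sx; apply: has_fderiv_comp; apply: has_fderiv_fderiv; [exact: df|apply/dg/ST].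
apply: (Cn_bilin (compB _ _ _)) => //.
by apply: IH => //; apply: Cn_pred.
Qed.

Lemma Cinfty_sub V W (S S' : set V) (f : V -> W) :
  S' `<=` S -> Cinfty S f -> Cinfty S' f.
Proof. by move=> SS Cf n; apply: Cn_sub (Cf n). Qed.

Lemma Cinfty_local V W (S : set V) (f : V -> W) :
  (forall x, S x -> exists2 N : set V, N x & Cinfty N f) -> Cinfty S f.
Proof. by move=> H n; apply: Cn_local => x /H[N Nx Cf]; exists N. Qed.

Lemma Cinfty_eq V W (S : set V) (f g : V -> W) : open S ->
  (forall x, S x -> f x = g x) -> Cinfty S f -> Cinfty S g.
Proof. by move=> oS fg Cf n; apply: Cn_eq (Cf n). Qed.

Lemma Cinfty_diff V W (S : set V) (f : V -> W) x :
  Cinfty S f -> S x -> differentiable f x.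
Proof. by move=> /(_ 1%N)[df _] /df. Qed.

Lemma Cinfty_fderiv V W (S : set V) (f : V -> W) : Cinfty S f -> Cinfty S (fderiv f).
Proof. by move=> Cf n; have [] := Cf n.+1. Qed.

Lemma Cinfty_cst V W (S : set V) (c : W) : open S -> Cinfty S (fun=> c).
Proof. by move=> oS n; apply: Cn_cst. Qed.

Lemma Cinfty_clin V W (S : set V) (l : clin V W) : open S -> Cinfty S l.
Proof. by move=> oS n; apply: Cn_clin. Qed.

Lemma CinftyD V W (S : set V) (f g : V -> W) : open S ->
  Cinfty S f -> Cinfty S g -> Cinfty S (fun x => f x + g x).
Proof. by move=> oS Cf Cg n; apply: CnD. Qed.

Lemma Cinfty_bilin U V W X (S : set X) (B : clin U (clin V W))
    (f : X -> U) (g : X -> V) : open S ->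
  Cinfty S f -> Cinfty S g -> Cinfty S (fun x => B (f x) (g x)).
Proof. by move=> oS Cf Cg n; apply: Cn_bilin. Qed.

Lemma Cinfty_comp U V W (S : set U) (T : set V) (f : U -> V) (g : V -> W) :
  open S -> (forall x, S x -> T (f x)) -> Cinfty S f -> Cinfty T g ->
  Cinfty S (fun x => g (f x)).
Proof. by move=> oS ST Cf Cg n; apply: Cn_comp (Cf n) (Cg n). Qed.

Lemma Cinfty_clin_comp U V W (S : set U) (l : clin V W) (f : U -> V) :
  open S -> Cinfty S f -> Cinfty S (fun x => l (f x)).
Proof.
move=> oS Cf; apply: (@Cinfty_comp _ _ _ S setT) => //.
by apply: Cinfty_clin; apply: openT.
Qed.

(** Evaluation of a linear map at a vector is bilinear. *)
Lemma Cinfty_app U V W (S : set U) (f : U -> clin V W) (g : U -> V) :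
  open S -> Cinfty S f -> Cinfty S g -> Cinfty S (fun x => f x (g x)).
Proof. by move=> oS Cf Cg; apply: (Cinfty_bilin (idL (clin V W))). Qed.

Lemma Cinfty_pair U V W (S : set U) (f : U -> V) (g : U -> W) : open S ->
  Cinfty S f -> Cinfty S g -> Cinfty S (fun x => (f x, g x)).
Proof.
move=> oS Cf Cg.
apply: (@Cinfty_eq _ _ _ (fun x => inlL V W (f x) + inrL V W (g x))) => //.
  by move=> x _; rewrite /= -[LHS]/(_ + 0, 0 + _) addr0 add0r.
by apply: CinftyD => //; apply: Cinfty_clin_comp.
Qed.

Lemma Cinfty_sum (I : Type) (r : seq I) (P : pred I) V W (S : set V)
    (f : I -> V -> W) : open S -> (forall i, P i -> Cinfty S (f i)) ->
  Cinfty S (fun x => \sum_(i <- r | P i) f i x).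
Proof.
move=> oS Cf; elim: r => [|i r IH].
  by apply: Cinfty_eq (Cinfty_cst 0 oS) => // x _; rewrite big_nil.
case: (boolP (P i)) => Pi; last first.
  by apply: Cinfty_eq IH => // x _; rewrite big_cons (negbTE Pi).
apply: Cinfty_eq (CinftyD oS (Cf i Pi) IH) => // x _.
by rewrite big_cons Pi.
Qed.

Lemma Cinfty_ffun (I : finType) V W (S : set V) (f : I -> V -> W) : open S ->
  (forall i, Cinfty S (f i)) -> Cinfty S (fun x => [ffun i => f i x] : {ffun I -> W}).
Proof.
move=> oS Cf.
apply: (@Cinfty_eq _ _ _ (fun x => \sum_i ffun_inL W i (f i x))) => //.
  move=> x _; apply/ffunP => j; rewrite sum_ffunE ffunE (bigD1 j)//= ffunE eqxx.
  rewrite big1 ?addr0// => i ij; rewrite ffunE.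
  by rewrite eq_sym (negbTE ij).
by apply: Cinfty_sum => // i _; apply: Cinfty_clin_comp.
Qed.

End Smooth.

(** * Derivatives of curves *)

Section Curves.
Context {R : realType}.
Implicit Types (U V W : normedModType R) (S : set R).

Lemma has_fderiv_derive1 V (c : R -> V) t l : has_fderiv c t l -> derive1 c t = l 1.
Proof. by move=> [dc <-]; rewrite derive1E' // fderivE. Qed.

Lemma derive1_fderiv V (c : R -> V) t : differentiable c t -> derive1 c t = fderiv c t 1.
Proof. by move=> /has_fderiv_fderiv/has_fderiv_derive1. Qed.

Lemma Cinfty_derive1 V S (c : R -> V) : open S -> Cinfty S c -> Cinfty S (derive1 c).
Proof.
move=> oS Cc; apply: (@Cinfty_eq _ _ _ _ (fun t => fderiv c t (1 : R))) => //.
  by move=> t St; rewrite derive1_fderiv//; apply: Cinfty_diff St.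
by apply: Cinfty_app => //; [apply: Cinfty_fderiv|apply: Cinfty_cst].
Qed.

Lemma derive1n_Cinfty V S (c : R -> V) n : open S -> Cinfty S c -> Cinfty S (derive1n n c).
Proof.
move=> oS Cc; elim: n => [|n IH]; first by rewrite derive1n0.
by rewrite derive1nS; apply: Cinfty_derive1.
Qed.

Lemma derive1_eq V S (c d : R -> V) : open S -> (forall t, S t -> c t = d t) ->
  forall t, S t -> derive1 c t = derive1 d t.
Proof.
move=> oS cd t St; rewrite !derive1E; apply: near_eq_derive.
exact: open_near_eq St.
Qed.

Lemma derive1n_eq V S (c d : R -> V) n : open S -> (forall t, S t -> c t = d t) ->
  forall t, S t -> derive1n n c t = derive1n n d t.
Proof.
move=> oS cd; elim: n => [|n IH] t St; first by rewrite !derive1n0 cd.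
by rewrite !derive1nS; apply: derive1_eq IH _ St.
Qed.

Lemma derive1_curveD V (c d : R -> V) t : differentiable c t -> differentiable d t ->
  derive1 (fun s => c s + d s) t = derive1 c t + derive1 d t.
Proof.
move=> dc dd; rewrite (derive1_fderiv dc) (derive1_fderiv dd).
have D := has_fderivD (has_fderiv_fderiv dc) (has_fderiv_fderiv dd).
exact: has_fderiv_derive1 D.
Qed.

Lemma derive1_postcomp V W (f : V -> W) (c : R -> V) t :
  differentiable c t -> differentiable f (c t) ->
  derive1 (fun s => f (c s)) t = fderiv f (c t) (derive1 c t).
Proof.
move=> dc df; rewrite (derive1_fderiv dc).
have D := has_fderiv_comp (has_fderiv_fderiv dc) (has_fderiv_fderiv df).
exact: has_fderiv_derive1 D.
Qed.

Lemma derive1_clin V W (f : clin V W) (c : R -> V) t :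
  differentiable c t -> derive1 (fun s => f (c s)) t = f (derive1 c t).
Proof.
by move=> dc; have [df E] := has_fderiv_clin f (c t); rewrite derive1_postcomp// E.
Qed.

Lemma derive1_bilin U V W (B : clin U (clin V W)) (f : R -> U) (g : R -> V) t :
  differentiable f t -> differentiable g t ->
  derive1 (fun s => B (f s) (g s)) t = B (derive1 f t) (g t) + B (f t) (derive1 g t).
Proof.
move=> df dg; rewrite (derive1_fderiv df) (derive1_fderiv dg).
have D := has_fderiv_bilin B (has_fderiv_fderiv df) (has_fderiv_fderiv dg).
exact: has_fderiv_derive1 D.
Qed.

Lemma derive1_app U V (f : R -> clin U V) (g : R -> U) t :
  differentiable f t -> differentiable g t ->
  derive1 (fun s => f s (g s)) t = derive1 f t (g t) + f t (derive1 g t).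
Proof. exact: (derive1_bilin (idL (clin U V))). Qed.

End Curves.

(** * Covariant differentiation along a curve *)

Section CovariantDerivative.
Context {R : realType} {E : normedModType R}.
Implicit Types (O : set E) (S : set R) (c : R -> E) (G : E -> clin E (clin E E)).

Definition covder G c (v : R -> E) (t : R) : E := derive1 v t + G (c t) (derive1 c t) (v t).

(** The index is shifted: [cov G c j] contains [j + 1] derivatives of [c]. *)
Definition cov G c (j : nat) : R -> E := iter j (covder G c) (derive1 c).

Lemma covS G c j t :
  cov G c j.+1 t = derive1 (cov G c j) t + G (c t) (derive1 c t) (cov G c j t).
Proof. by []. Qed.

Lemma cov_Cinfty G c O S j : open S -> open O -> (forall t, S t -> O (c t)) ->
  Cinfty O G -> Cinfty S c -> Cinfty S (cov G c j).
Proof.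
move=> oS oO SO CG Cc; elim: j => [|j IH]; first exact: Cinfty_derive1.
apply: CinftyD => //; first exact: Cinfty_derive1.
do 2!apply: Cinfty_app => //; last exact: Cinfty_derive1.
exact: (@Cinfty_comp _ _ _ _ _ O).
Qed.

Lemma cov_eq G c d S j : open S -> (forall t, S t -> c t = d t) ->
  forall t, S t -> cov G c j t = cov G d j t.
Proof.
move=> oS cd; elim: j => [|j IH] t St; first exact: derive1_eq cd _ St.
by rewrite !covS (derive1_eq oS IH)// IH// cd// (derive1_eq oS cd).
Qed.

(** Both sides agree for [j = 0] by the chain rule.  Differentiating
    [fderiv phi (c t) (v t)] creates the term in the second derivative of [phi]
    that the transformation law of [G] absorbs. *)
Lemma cov_change G G' (phi : E -> E) c O S j : open S -> open O ->
  (forall t, S t -> O (c t)) -> Cinfty O G -> Cinfty S c -> Cinfty O phi ->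
  (forall x xi y, O x -> fderiv phi x (G x xi y) =
    fderiv (fderiv phi) x xi y + G' (phi x) (fderiv phi x xi) (fderiv phi x y)) ->
  forall t, S t -> cov G' (fun s => phi (c s)) j t = fderiv phi (c t) (cov G c j t).
Proof.
move=> oS oO SO CG Cc Cphi law.
have dphi t : S t -> derive1 (fun s => phi (c s)) t = fderiv phi (c t) (derive1 c t).
  move=> St; apply: derive1_postcomp; first exact: Cinfty_diff Cc St.
  exact: Cinfty_diff Cphi (SO _ St).
elim: j => [//|j IH] t St; rewrite !covS (derive1_eq oS IH)// IH// dphi//.
have dcov : differentiable (cov G c j) t.
  exact: Cinfty_diff (cov_Cinfty j oS oO SO CG Cc) St.
have dc : differentiable c t by apply: Cinfty_diff Cc St.
have dfphi : differentiable (fderiv phi) (c t).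
  by apply: Cinfty_diff (SO _ St); apply: Cinfty_fderiv.
have [dfc _] := has_fderiv_comp (has_fderiv_fderiv dc) (has_fderiv_fderiv dfphi).
rewrite derive1_app// derive1_postcomp//.
rewrite clin_funD law; last exact: SO.
by rewrite [RHS]addrCA addrA.
Qed.

End CovariantDerivative.

(* Unification would otherwise unfold derivatives and coordinate maps when it
   compares applications of unrelated linear maps. *)
Opaque fderiv.

(** * Covariant derivatives as functions of the jet *)

Section JetCoordinates.
Context {R : realType} {E : normedModType R}.
Variable k : nat.

Local Notation X := (E * {ffun 'I_k -> E})%type.
Implicit Types (w u : X) (i j : nat).

(** All coordinates of a jet, the base point being number 0 and the derivative of
    order [i] number [i]; the value is 0 beyond the order of the jet, so that the
    shift below needs no case distinction. *)
Definition crd i : clin X E :=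
  if i is i'.+1 then
    if insub i' is Some o then compL (ffun_atL E o) (sndL E _) else 0
  else fstL E _.

Lemma crd0 w : crd 0 w = w.1. Proof. by []. Qed.

Lemma crdS (o : 'I_k) w : crd o.+1 w = w.2 o.
Proof. by rewrite /crd valK. Qed.

Lemma crd_big i w : (k < i)%N -> crd i w = 0.
Proof. by case: i => [//|i] ki; rewrite /crd insubF// ltnNge -ltnS ki. Qed.

Lemma crd_ext w u : (forall i, (i <= k)%N -> crd i w = crd i u) -> w = u.
Proof.
move=> H; rewrite [w]surjective_pairing [u]surjective_pairing; congr pair.
  by rewrite -!crd0 (H 0%N).
by apply/ffunP => o; rewrite -!crdS H.
Qed.

Lemma crd_norm i w : `|crd i w| <= `|w|.
Proof.
case: i => [|i]; first by rewrite [leRHS]prod_normE le_max lexx.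
have [ki|ik] := leqP k i; first by rewrite crd_big// normr0.
rewrite -[i]/(Ordinal ik : nat) crdS [leRHS]prod_normE le_max.
by rewrite (ffun_norm_ge w.2) orbT.
Qed.

#[local] Opaque crd.

(** The total derivative of jets: it maps the jet of [c] to that of [c'], except
    for the last coordinate, which a jet of order [k] does not determine. *)
Definition jshift w : X := (crd 1 w, [ffun o : 'I_k => crd o.+2 w]).

Lemma crd_jshift i w : crd i (jshift w) = crd i.+1 w.
Proof.
case: i => [//|i]; have [ki|ik] := leqP k i; first by rewrite !crd_big// ltnW.
by rewrite -[i]/(Ordinal ik : nat) crdS ffunE.
Qed.

Fact trunc_linear j :
  linear (fun w => (w.1, [ffun o : 'I_k => if (o < j)%N then w.2 o else 0]) : X).
Proof.
move=> a w u; congr pair; apply/ffunP => o; rewrite !ffunE.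
by case: ifP; rewrite ?scaler0 ?addr0.
Qed.

Fact trunc_bound j w :
  `|(w.1, [ffun o : 'I_k => if (o < j)%N then w.2 o else 0]) : X| <= 1 * `|w|.
Proof.
rewrite mul1r [leLHS]prod_normE ge_max (crd_norm 0)/=.
apply: ffun_norm_le => // o; rewrite ffunE; case: ifP => _; last by rewrite normr0.
by rewrite -crdS crd_norm.
Qed.

Definition trunc j : clin X X := mk_clin (@trunc_linear j) (@trunc_bound j).

Lemma crd_trunc i j w : (i <= j)%N -> crd i (trunc j w) = crd i w.
Proof.
case: i => [//|i] ij; have [ki|ik] := leqP k i; first by rewrite !crd_big.
by rewrite -[i]/(Ordinal ik : nat) !crdS ffunE ij.
Qed.

Lemma trunc_fst j w : (trunc j w).1 = w.1. Proof. by []. Qed.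

Lemma trunc_eq j w u : (forall i, (i <= j)%N -> crd i w = crd i u) ->
  trunc j w = trunc j u.
Proof.
move=> H; congr pair; first by rewrite -!crd0 (H 0%N).
by apply/ffunP => o; rewrite !ffunE; case: ifP => // oj; rewrite -!crdS H.
Qed.

#[local] Opaque trunc.

Definition jet_curve (c : R -> E) (t : R) : X :=
  (c t, [ffun o : 'I_k => derive1n o.+1 c t]).

Lemma crd_jet_curve c t i : (i <= k)%N -> crd i (jet_curve c t) = derive1n i c t.
Proof. by case: i => [//|i] ik; rewrite -[i]/(Ordinal ik : nat) crdS ffunE. Qed.

Lemma jet_curve_Cinfty S c : open S -> Cinfty S c -> Cinfty S (jet_curve c).
Proof.
move=> oS Cc; apply: Cinfty_pair => //; apply: Cinfty_ffun => // o.
exact: (derive1n_Cinfty o.+1 oS Cc).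
Qed.

Section CovariantJet.
Variables (G : E -> clin E (clin E E)) (O : set E).
Hypotheses (oO : open O) (CG : Cinfty O G).

Definition jdom : set X := [set w | O w.1].

Lemma jdom_open : open jdom.
Proof.
apply: (@open_comp _ _ (fstL E {ffun 'I_k -> E}) O) => // x _.
exact: (@clin_cont _ _ _ (fstL E {ffun 'I_k -> E})).
Qed.

(** [covP j] is the difference of [cov j] and the derivative of order [j + 1],
    as a function of the jet; the recursion is the product rule applied to the
    recursion of [cov]. *)
Fixpoint covP (j : nat) : X -> E :=
  if j is i.+1 then fun w =>
    fderiv (covP i) w (jshift w) + G w.1 (crd 1 w) (crd i.+1 w + covP i w)
  else fun=> 0.

Lemma covPS j w : covP j.+1 w =
  fderiv (covP j) w (jshift w) + G w.1 (crd 1 w) (crd j.+1 w + covP j w).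
Proof. by []. Qed.

Lemma jshift_Cinfty (S : set X) : open S -> Cinfty S jshift.
Proof.
move=> oS; apply: Cinfty_pair => //; first exact: Cinfty_clin.
by apply: Cinfty_ffun => // o; apply: Cinfty_clin.
Qed.

Lemma covP_Cinfty j : Cinfty jdom (covP j).
Proof.
have oX := jdom_open.
have fst_C : Cinfty jdom (fun w : X => w.1) by exact: (Cinfty_clin (fstL _ _)).
elim: j => [|j IH]; first exact: Cinfty_cst.
apply: CinftyD => //.
  by apply: Cinfty_app => //; [apply: Cinfty_fderiv|apply: jshift_Cinfty].
apply: Cinfty_app => //; last by apply: CinftyD => //; apply: Cinfty_clin.
apply: Cinfty_app => //; last exact: Cinfty_clin.
by apply: (@Cinfty_comp _ _ _ _ _ O).
Qed.

Definition depends_upto j (f : X -> E) := forall w u, jdom w -> jdom u ->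
  (forall i, (i <= j)%N -> crd i w = crd i u) -> f w = f u.

(** A function of the coordinates up to [j] factors through the projection
    [trunc j], and the chain rule passes this on to its derivative. *)
Lemma fderiv_trunc j (f : X -> E) w h : Cinfty jdom f -> depends_upto j f -> jdom w ->
  fderiv f w h = fderiv f (trunc j w) (trunc j h).
Proof.
move=> Cf fdep Xw; have trX w' : jdom w' -> jdom (trunc j w') by rewrite /jdom /= trunc_fst.
have d : has_fderiv f (trunc j w) (fderiv f (trunc j w)).
  by apply: has_fderiv_fderiv; apply: Cinfty_diff Cf (trX _ Xw).
suff [_ ->] : has_fderiv f w (compL (fderiv f (trunc j w)) (trunc j)) by [].
apply: has_fderiv_near (has_fderiv_comp (has_fderiv_clin (trunc j) w) d).
apply: open_near_eq jdom_open _ Xw => v Xv; apply: fdep (trX _ Xv) Xv _ => i ij.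
by rewrite crd_trunc.
Qed.

Lemma covP_dep j : depends_upto j (covP j).
Proof.
elim: j => [//|j IH] w u Xw Xu wu.
have wuj i : (i <= j)%N -> crd i w = crd i u by move=> ij; apply/wu/leqW.
have w1 : w.1 = u.1 by by rewrite -!crd0 (wu 0%N).
have e1 : fderiv (covP j) w (jshift w) = fderiv (covP j) u (jshift u).
  have tw := fderiv_trunc (jshift w) (covP_Cinfty j) IH Xw.
  have tu := fderiv_trunc (jshift u) (covP_Cinfty j) IH Xu.
  apply: etrans tw _; apply: etrans (esym tu).
  have h1 := trunc_eq wuj.
  have h2 : trunc j (jshift w) = trunc j (jshift u).
    apply: trunc_eq => i ij.
    rewrite !crd_jshift.
    exact: wu.
  exact: (f_equal2 (fun a b => clin_fun (fderiv (covP j) a) b) h1 h2).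
have e2 : covP j w = covP j u by exact: IH.
have e3 : crd 1 w = crd 1 u by exact: wu.
have e4 : crd j.+1 w = crd j.+1 u by exact: wu.
rewrite (covPS j w) (covPS j u) w1 e2 e4; congr (_ + _) => //.
by rewrite e3.
Qed.

Lemma fderiv_covP j w h h' : jdom w ->
  (forall i, (i <= j)%N -> crd i h = crd i h') ->
  fderiv (covP j) w h = fderiv (covP j) w h'.
Proof.
move=> Xw hh; have D v := fderiv_trunc v (covP_Cinfty j) (@covP_dep j) Xw.
by apply: etrans (D h) _; apply: etrans (esym (D h')); congr (clin_fun _ _); apply: trunc_eq.
Qed.

(** The derivative of [jet_curve c] and the shift of [jet_curve c] differ in the
    last coordinate only, which [covP j] ignores because [j + 1 < k]. *)
Lemma cov_jet c S j : open S -> Cinfty S c -> (forall t, S t -> O (c t)) ->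
  (j < k)%N -> forall t, S t ->
  cov G c j t = derive1n j.+1 c t + covP j (jet_curve c t).
Proof.
move=> oS Cc SO; elim: j => [|j IH] jk t St; first by rewrite addr0.
have jk' : (j < k)%N by apply: ltnW.
have dJ : differentiable (jet_curve c) t.
  by apply: Cinfty_diff St; apply: jet_curve_Cinfty.
have dP : differentiable (covP j) (jet_curve c t).
  by apply: (Cinfty_diff (covP_Cinfty j)); apply: SO.
rewrite covS (derive1_eq oS (IH jk'))// derive1_curveD//; first last.
- exact: differentiable_comp.
- exact: Cinfty_diff (derive1n_Cinfty _ oS Cc) St.
rewrite -derive1nS -addrA derive1_postcomp//; congr (_ + _).
rewrite covPS crd_jet_curve ?(leq_trans _ jk)// crd_jet_curve// -IH//; congr (_ + _).
apply: fderiv_covP => [|i ij]; first exact: SO.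
have ik : (i < k)%N by apply: leq_ltn_trans ij jk'.
rewrite crd_jshift crd_jet_curve// -derive1_clin// derive1nS.
apply: (derive1_eq oS) St => s Ss; rewrite crd_jet_curve//; exact: ltnW.
Qed.

End CovariantJet.
End JetCoordinates.

#[local] Opaque fderiv crd trunc.
(** * Frame coordinates on jets *)

Section CovariantFrame.
Context {R : realType} {E : normedModType R}.
Variable k : nat.

Local Notation X := (E * {ffun 'I_k -> E})%type.
Implicit Types (w u : X) (i j : nat).
Variables (G : E -> clin E (clin E E)) (O : set E).
Hypotheses (oO : open O) (CG : Cinfty O G).

Definition frame_of_jet w : X := (w.1, [ffun o : 'I_k => w.2 o + covP G o w]).

(** The jet with frame [u] is the fixed point of this map.  Each application
    makes one more coordinate correct, since [covP o] involves only the
    coordinates up to [o]; so [k] applications reach the fixed point from any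
    start with the right base point. *)
Definition unframe_step u w : X := (u.1, [ffun o : 'I_k => u.2 o - covP G o w]).

Definition unframe m u : X := iter m (unframe_step u) (u.1, 0).

Definition jet_of_frame u : X := unframe k u.

Lemma frame_of_jet_step w u : frame_of_jet w = u <-> unframe_step u w = w.
Proof.
split=> [<-|wE].
  rewrite [RHS]surjective_pairing; congr pair; apply/ffunP => o.
  by rewrite !ffunE addrK.
rewrite [RHS]surjective_pairing; congr pair; first by rewrite -[in LHS]wE.
by apply/ffunP => o; rewrite ffunE -{1}wE ffunE subrK.
Qed.

Lemma unframe_step_agree u w w' m : jdom O w -> jdom O w' ->
  (forall i, (i <= m)%N -> crd k i w = crd k i w') ->
  forall i, (i <= m.+1)%N ->
    crd k i (unframe_step u w) = crd k i (unframe_step u w').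
Proof.
move=> Xw Xw' ww' [|i] im; first by rewrite !crd0.
have [ki|ik] := leqP k i; first by rewrite !crd_big.
rewrite -[i]/(Ordinal ik : nat) !crdS !ffunE; congr (_ - _).
apply: (covP_dep oO CG) => // l li; apply: ww'; exact: leq_trans li im.
Qed.

Lemma unframe_fst m u : (unframe m u).1 = u.1.
Proof. by case: m. Qed.

Lemma unframe_agree u w m : O u.1 -> unframe_step u w = w ->
  forall i, (i <= m)%N -> crd k i (unframe m u) = crd k i w.
Proof.
move=> Ou wE; have Ow : jdom O w by rewrite -wE.
elim: m => [|m IH] i im.
  by move: im; rewrite leqn0 => /eqP->; rewrite !crd0 -wE.
rewrite -wE; apply: unframe_step_agree im => //.
by rewrite /jdom/= -/(unframe m u) unframe_fst.
Qed.

Lemma unframe_agreeS u m : O u.1 ->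
  forall i, (i <= m)%N -> crd k i (unframe m.+1 u) = crd k i (unframe m u).
Proof.
move=> Ou; elim: m => [|m IH] i im.
  by move: im; rewrite leqn0 => /eqP->; rewrite !crd0.
by apply: unframe_step_agree im => //; rewrite /jdom/= unframe_fst.
Qed.

Lemma frame_of_jetK w : O w.1 -> jet_of_frame (frame_of_jet w) = w.
Proof.
move=> Ow; apply: crd_ext => i ik; apply: unframe_agree => //.
exact/frame_of_jet_step.
Qed.

Lemma jet_of_frameK u : O u.1 -> frame_of_jet (jet_of_frame u) = u.
Proof.
move=> Ou; apply/frame_of_jet_step; apply: crd_ext => i ik.
exact: unframe_agreeS.
Qed.

Lemma frame_of_jet_Cinfty : Cinfty (jdom O) frame_of_jet.
Proof.
have oX := jdom_open (k := k) oO; apply: Cinfty_pair => //.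
  exact: (Cinfty_clin (fstL _ _)).
apply: Cinfty_ffun => // o; apply: CinftyD => //.
  exact: (Cinfty_clin (compL (ffun_atL E o) (sndL _ _))).
exact: (covP_Cinfty k oO CG o).
Qed.

Lemma unframe_Cinfty m : Cinfty (jdom O) (unframe m).
Proof.
have oX := jdom_open (k := k) oO; elim: m => [|m IH].
  apply: Cinfty_pair => //; first exact: (Cinfty_clin (fstL _ _)).
  exact: Cinfty_cst.
apply: Cinfty_pair => //; first exact: (Cinfty_clin (fstL _ _)).
apply: Cinfty_ffun => // o; apply: CinftyD => //.
  exact: (Cinfty_clin (compL (ffun_atL E o) (sndL _ _))).
apply: (@Cinfty_clin_comp _ _ _ _ _ (- idL E)) => //.
apply: (Cinfty_comp oX _ IH (covP_Cinfty k oO CG o)) => u Xu.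
by rewrite /jdom/= unframe_fst.
Qed.

Lemma jet_of_frame_Cinfty : Cinfty (jdom O) jet_of_frame.
Proof. exact: unframe_Cinfty. Qed.

Lemma cov_frame c S t : open S -> Cinfty S c -> (forall s, S s -> O (c s)) -> S t ->
  (c t, [ffun o : 'I_k => cov G c o t]) = frame_of_jet (jet_curve k c t).
Proof.
move=> oS Cc SO St; congr pair; apply/ffunP => o; rewrite !ffunE.
exact: (cov_jet oO CG oS Cc SO (ltn_ord o) St).
Qed.

End CovariantFrame.

(** * Curves with a prescribed jet *)

Section PolynomialCurve.
Context {R : realType} {E : normedModType R}.
Variable k : nat.

Local Notation X := (E * {ffun 'I_k -> E})%type.
Implicit Types (w u : X) (i j : nat).

(** Here the coordinates of [w] are derivatives, not Taylor coefficients, whence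
    the factorials. *)
Definition taylor_curve w (t : R) : E :=
  \sum_(i < k.+1) ((i`!%:R)^-1 * t ^+ i) *: crd k i w.

Lemma exp_Cinfty i (a : R) : Cinfty setT (fun t : R => a * t ^+ i).
Proof.
have oT := @openT R; elim: i => [|i IH].
  by apply: Cinfty_eq (Cinfty_cst a oT) => // x _; rewrite expr0 mulr1.
apply: Cinfty_eq (Cinfty_bilin (scaleB R) oT IH (Cinfty_clin (idL R) oT)) => // x _.
by rewrite exprSr mulrA.
Qed.

Lemma taylor_curve_Cinfty w : Cinfty setT (taylor_curve w).
Proof.
have oT := @openT R; apply: Cinfty_sum => // i _.
exact: (Cinfty_bilin (scaleB E) oT (exp_Cinfty _ _) (Cinfty_cst _ oT)).
Qed.

Lemma derive1_exp i (a t : R) :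
  derive1 (fun s : R => a * s ^+ i) t = i%:R * a * t ^+ i.-1.
Proof.
by rewrite derive1Ml ?exp_derive1 1?mulrCA ?mulrA//; apply: exprn_derivable.
Qed.

Lemma derive1_curve_sum n (f : 'I_n -> R -> E) t :
  (forall i : 'I_n, differentiable (f i) t) ->
  derive1 (fun s => \sum_(o < n) f o s) t = \sum_(o < n) derive1 (f o) t.
Proof.
move=> df; rewrite derive1E.
have -> : (fun s => \sum_(o < n) f o s) = \sum_(o < n) f o.
  by apply/funext => s; rewrite fct_sumE.
rewrite derive_sum; last by move=> i; apply: diff_derivable.
by apply: eq_bigr => i _; rewrite derive1E.
Qed.

Lemma derive1_taylor w : derive1 (taylor_curve w) = taylor_curve (jshift w).
Proof.
apply/funext => t; rewrite derive1_curve_sum; last first.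
  move=> i; apply: (@Cinfty_diff _ _ _ setT) => //.
  exact: (Cinfty_bilin (scaleB E) openT (exp_Cinfty _ _) (Cinfty_cst _ openT)).
have D (i : nat) : derive1 (fun s => ((i`!%:R)^-1 * s ^+ i) *: crd k i w) t =
    (i%:R * (i`!%:R)^-1 * t ^+ i.-1) *: crd k i w.
  rewrite -derive1_exp.
  apply: (derive1_clin (flipL (scaleB E) (crd k i w))).
  exact: Cinfty_diff (exp_Cinfty _ _) I.
under eq_bigr do rewrite D.
rewrite big_ord_recl mul0r mul0r scale0r add0r /taylor_curve big_ord_recr/=.
rewrite [crd k k _]crd_jshift crd_big// scaler0 addr0.
apply: eq_bigr => i _; rewrite crd_jshift factS natrM invfM mulrA divff ?mul1r//.
by rewrite pnatr_eq0.
Qed.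

Lemma taylor_curve0 w : taylor_curve w 0 = crd k 0 w.
Proof.
rewrite /taylor_curve big_ord_recl/= fact0 invr1 expr0 mul1r scale1r big1 ?addr0// => i _.
by rewrite expr0n/= mulr0 scale0r.
Qed.

Lemma derive1n_taylor j w :
  derive1n j (taylor_curve w) = taylor_curve (iter j (@jshift _ _ _) w).
Proof. by elim: j => [//|j IH]; rewrite derive1nS IH derive1_taylor. Qed.

Lemma jet_taylor_curve w : jet_curve k (taylor_curve w) 0 = w.
Proof.
apply: crd_ext => i ik; rewrite crd_jet_curve// derive1n_taylor taylor_curve0.
suff H j : crd k 0 (iter j (@jshift _ _ _) w) = crd k j w by exact: H.
have H i' : crd k i' (iter j (@jshift _ _ _) w) = crd k (i' + j) w; last by rewrite H.
elim: j i' => [|j IH] i'; first by rewrite addn0.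
by rewrite iterS crd_jshift IH addSnnS.
Qed.

End PolynomialCurve.

(** * Charts and smooth curves *)

Section LocalRepresentation.
Context {R : realType} {E F : normedModType R} {X Y : Type}.
Variables (AX : atlas E X) (AY : atlas F Y).

(** [local_rep] chooses among the images of all points with the given
    coordinates; the first hypothesis says that the choice is immaterial. *)
Lemma local_repE (f : X -> Y) (a : aidx AX) (b : aidx AY) (h : E -> F) x :
  (forall x', adom a x' -> adom b (f x') -> achart a x' = achart a x ->
    achart b (f x') = h (achart a x)) ->
  adom a x -> adom b (f x) -> local_rep f a b (achart a x) = h (achart a x).
Proof.
move=> H ax bfx; rewrite /local_rep; case: xgetP => [y _ [x' [ax' bx' xx' <-]]|].
  exact: H.
by move=> /(_ (achart b (f x)))[]; exists x.
Qed.

(** Smoothness is always checked through an explicit formula [h] for the local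
    representative. *)
Lemma smooth_on_chart (S : set X) (f : X -> Y) (a : aidx AX) (b : aidx AY)
    (O : set E) (h : E -> F) :
  achart a @` (S `&` adom a `&` f @^-1` adom b) = O ->
  open O -> Cinfty O h ->
  (forall x, adom a x -> adom b (f x) -> O (achart a x) ->
    achart b (f x) = h (achart a x)) ->
  let O' := achart a @` (S `&` adom a `&` f @^-1` adom b) in
  open O' /\ Cinfty O' (local_rep f a b).
Proof.
move=> OE oO Ch fh; rewrite /= OE; split=> //; apply: Cinfty_eq Ch => // e Oe.
move: (Oe); rewrite -{1}OE => -[x [[Sx ax] bfx] xe]; rewrite -xe; apply/esym/local_repE => //.
by move=> x' ax' bx' xx'; rewrite -xx'; apply: fh => //; rewrite xx' xe.
Qed.

End LocalRepresentation.

Section Charts.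
Context {R : realType} {E : normedModType R} {M : topologicalType}.
Context {A : atlas E M} (hM : smooth_manifold A).
Implicit Types (a b c : aidx A) (x : M) (g : R -> M).

Lemma chart_inj a x y : adom a x -> adom a y -> achart a x = achart a y -> x = y.
Proof. by move=> ax ay; apply: (achart_inj hM); rewrite inE. Qed.

Lemma chart_image_open a (P : set M) : open P -> P `<=` adom a ->
  open (achart a @` P).
Proof.
by move=> oP Pa; have := achart_open hM a oP; rewrite (setIidl Pa).
Qed.

Lemma chart_image_mem a (P : set M) x : P `<=` adom a -> adom a x ->
  (achart a @` P) (achart a x) -> P x.
Proof.
move=> Pa ax [y Py yx]; suff -> : x = y by [].
by apply: chart_inj (esym yx) => //; apply: Pa.
Qed.

Lemma dom2_open a b : open (achart a @` (adom a `&` adom b)).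
Proof.
apply: chart_image_open; last by move=> x [].
by apply: openI; apply: (adom_open hM).
Qed.

Lemma dom1_open a : open (achart a @` adom a).
Proof. by apply: chart_image_open => //; apply: (adom_open hM). Qed.

Lemma transE a b x : adom a x -> adom b x -> trans a b (achart a x) = achart b x.
Proof.
move=> ax bx; apply: (@local_repE _ _ _ _ _ A A idfun a b (fun=> achart b x)) => //.
move=> x' ax' bx' xx'; suff -> : x' = x by [].
exact: chart_inj xx'.
Qed.

Lemma trans_diff a b x : adom a x -> adom b x ->
  differentiable (trans a b) (achart a x).
Proof.
by move=> ax bx; apply: (Cinfty_diff (trans_smooth hM a b)); exists x.
Qed.

Lemma trans_comp_near a b c x : adom a x -> adom b x -> adom c x ->
  {near achart a x, (fun e => trans b c (trans a b e)) =1 trans a c}.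
Proof.
move=> ax bx cx.
apply: (@open_near_eq _ _ _ (achart a @` (adom a `&` (adom b `&` adom c)))).
- apply: chart_image_open; last by move=> y [].
  by do 2?[apply: openI; try exact: (adom_open hM)].
- by move=> _ [y [ay [by' cy]] <-]; rewrite !transE.
- by exists x.
Qed.

Lemma fderiv_trans_comp a b c x v : adom a x -> adom b x -> adom c x ->
  fderiv (trans b c) (achart b x) (fderiv (trans a b) (achart a x) v) =
  fderiv (trans a c) (achart a x) v.
Proof.
move=> ax bx cx; rewrite -compLE.
suff [_ ->] : has_fderiv (trans a c) (achart a x)
  (compL (fderiv (trans b c) (achart b x)) (fderiv (trans a b) (achart a x))) by [].
apply: has_fderiv_near (trans_comp_near ax bx cx) _.
apply: has_fderiv_comp; first by apply: has_fderiv_fderiv; apply: trans_diff.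
by rewrite transE//; apply: has_fderiv_fderiv; apply: trans_diff.
Qed.

Lemma fderiv_trans_id a x v : adom a x -> fderiv (trans a a) (achart a x) v = v.
Proof.
move=> ax; suff [_ ->] : has_fderiv (trans a a) (achart a x) (idL E) by [].
apply: has_fderiv_near (has_fderiv_clin (idL E) _).
apply: (open_near_eq (dom1_open a)); last by exists x.
by move=> _ [y ay <-]; rewrite transE.
Qed.

(** The openness that [smooth_on] requires of images provides the neighbourhood
    of 0. *)
Lemma curve_chart a g : smooth_curve A g -> adom a (g 0) ->
  exists S : set R, [/\ open S, S 0, forall t, S t -> adom a (g t) &
    Cinfty S (achart a \o g)].
Proof.
move=> [e e0 sg] ag0; have [oO CO] := sg tt a.
set O := (X in open X) in oO CO.
have Oin t : O t <-> (`]- e, e[%classic t /\ adom a (g t)).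
  split; first by move=> [s [[es _] ags] <-].
  by move=> [et agt]; exists t => //; split.
exists O; split=> //.
- by apply/Oin; split=> //; rewrite /= in_itv/= oppr_lt0 e0.
- by move=> t /Oin[].
apply: Cinfty_eq CO => // t /Oin[_ agt].
by apply: (@local_repE _ _ _ _ _ (id_atlas R) A g tt a (achart a \o g) t) => // t' _ _ /= ->.
Qed.

(** As curves are meaningful near 0 only, the lift of [c] may take an arbitrary
    value [x0] where [c] is outside the image of the chart. *)
Lemma exists_curve a (c : R -> E) : Cinfty setT c -> (achart a @` adom a) (c 0) ->
  exists g, smooth_curve A g /\ exists S : set R, [/\ open S, S 0,
    forall t, S t -> adom a (g t) & forall t, S t -> achart a (g t) = c t].
Proof.
move=> Cc ac0; have [x0 ax0 x0c] := ac0.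
pose g t := xget x0 [set x | adom a x /\ achart a x = c t].
pose S := c @^-1` (achart a @` adom a).
have gP t : S t -> adom a (g t) /\ achart a (g t) = c t.
  rewrite /g => -[x ax xc]; case: xgetP => [y _ []//|/(_ x)[]//].
have cont : continuous c.
  by move=> t; apply: (Cn_continuous (Cc 0%N)); rewrite inE.
have open_pre (O : set E) : open O -> open (c @^-1` O).
  by move=> oO; apply: open_comp => // t _; apply: cont.
have oS : open S by apply: open_pre; apply: dom1_open.
exists g; split; last first.
  by exists S; split=> // t /gP[].
have /nbhs_ballP[e /= e0 eS] : nbhs (0 : R) S by apply: open_nbhs_nbhs.
have eS' t : `]- e, e[%classic t -> S t.
  rewrite /= in_itv/= => te; apply: eS; rewrite -ball_normE /= sub0r normrN.
  by rewrite ltr_norml.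
have gE t x : S t -> adom a x -> achart a x = c t -> g t = x.
  move=> /gP[agt gc] ax xc; by apply: chart_inj agt ax _; rewrite gc.
exists e => // -[] b.
pose O := `]- e, e[%classic `&` c @^-1` (achart a @` (adom a `&` adom b)).
have oO : open O by apply: openI; [exact: itv_open|apply/open_pre/dom2_open].
apply: (@smooth_on_chart _ _ _ _ _ _ _ _ _ _ _ O (trans a b \o c)) => //.
- apply/seteqP; split=> t.
    move=> [s [[es _] bgs] <-]; split=> //; have [ags gc] := gP _ (eS' _ es).
    by exists (g s).
  move=> [et [x [ax bx] xc]]; exists t => //; split=> //.
  by rewrite /= (gE t x)//; apply: eS'.
- apply: (@Cinfty_comp _ _ _ _ _ (achart a @` (adom a `&` adom b))) => //.
  + by move=> t [].
  + exact: Cinfty_sub Cc.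
  + exact: (trans_smooth hM).
- move=> t _ bgt [et [x [ax bx] xc]]; have gtx := gE _ _ (eS' _ et) ax xc.
  by rewrite /= gtx -xc transE.
Qed.

End Charts.

(** * Frames of jets on a manifold *)

Section JetFrames.
Context {R : realType} {E : normedModType R} {M : topologicalType}.
Context {A : atlas E M} (hM : smooth_manifold A).
Variables (Gamma : aidx A -> E -> clin E (clin E E)).
Hypothesis (hG : linear_connection Gamma).
Implicit Types (a b : aidx A) (x : M) (g h : R -> M) (k : nat).

Local Notation cdom a := (achart a @` adom a).

Definition curve_frame k a g : {ffun 'I_k -> E} :=
  [ffun o : 'I_k => cov (Gamma a) (achart a \o g) o 0].

Lemma curve_frame_change k a b g : smooth_curve A g ->
  adom a (g 0) -> adom b (g 0) -> curve_frame k b g =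
  [ffun o => fderiv (trans a b) (achart a (g 0)) (curve_frame k a g o)].
Proof.
move=> sg ag0 bg0; apply/ffunP => o; rewrite !ffunE.
have [S [oS S0 aS CS]] := curve_chart sg ag0.
have [T [oT T0 bT _]] := curve_chart sg bg0.
have oST : open (S `&` T) by exact: openI.
pose O := achart a @` (adom a `&` adom b).
have oO : open O by exact: dom2_open.
have STO t : (S `&` T) t -> O (achart a (g t)).
  by move=> [/aS agt /bT bgt]; exists (g t).
rewrite -(@cov_change _ _ (Gamma a) (Gamma b) (trans a b) (achart a \o g) O (S `&` T))//.
- apply: (cov_eq _ _ oST) => // t [/aS agt /bT bgt].
  by rewrite /= (transE hM).
- apply: Cinfty_sub (hG.1 a); by move=> _ [x [ax _] <-]; exists x.
- by apply: Cinfty_sub CS; apply: subIsetl.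
- exact: (trans_smooth hM).
- by move=> x xi y Ox; apply: hG.2.
Qed.

Lemma curve_frame_jet k a g : smooth_curve A g -> adom a (g 0) ->
  (achart a (g 0), curve_frame k a g) =
  frame_of_jet (Gamma a) (jet_curve k (achart a \o g) 0).
Proof.
move=> sg ag0; have [S [oS S0 aS CS]] := curve_chart sg ag0.
rewrite -(cov_frame k (dom1_open hM a) (hG.1 a) oS CS)//.
by move=> t /aS agt; exists (g t).
Qed.

Lemma jet_curve_frame k a g : smooth_curve A g -> adom a (g 0) ->
  jet_curve k (achart a \o g) 0 =
  jet_of_frame (Gamma a) (achart a (g 0), curve_frame k a g).
Proof.
move=> sg ag0; rewrite curve_frame_jet// (frame_of_jetK (dom1_open hM a) (hG.1 a))//.
by exists (g 0).
Qed.

(** Equality of jets is stated in some chart [b]; frames transport it to any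
    other chart because they change by a map depending on the base point only,
    and a jet is recovered from its frame. *)
Lemma jet_eq_frame k a g h : smooth_curve A g -> smooth_curve A h -> adom a (g 0) ->
  jet_eq A k g h <-> g 0 = h 0 /\ curve_frame k a g = curve_frame k a h.
Proof.
move=> sg sh ag0; split=> -[gh0].
  move=> [b bg0 bgh]; split=> //.
  have bh0 : adom b (h 0) by rewrite -gh0.
  have ah0 : adom a (h 0) by rewrite -gh0.
  have J : jet_curve k (achart b \o g) 0 = jet_curve k (achart b \o h) 0.
    congr pair; first by rewrite /= gh0.
    by apply/ffunP => o; rewrite !ffunE; apply: (bgh o.+1 (ltn_ord o)).
  have [_ F] : (achart b (g 0), curve_frame k b g) = (achart b (h 0), curve_frame k b h).
    by rewrite !curve_frame_jet// J.
  by rewrite (curve_frame_change k sg bg0 ag0) (curve_frame_change k sh bh0 ah0) F gh0.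
move=> F; split=> //; exists a => // -[//|j] /= jk.
have ah0 : adom a (h 0) by rewrite -gh0.
have := jet_curve_frame k sg ag0; rewrite F gh0 -jet_curve_frame//.
by move=> [_] /ffunP /(_ (Ordinal (jk : (j < k)%N))); rewrite !ffunE.
Qed.

Lemma jet_repr_smooth k (t : jet A k) : smooth_curve A (jet_repr t).
Proof. by rewrite /jet_repr; case: cid2. Qed.

Lemma jet_repr_class k (t : jet A k) : sval t = jet_class A k (jet_repr t).
Proof. by rewrite /jet_repr; case: cid2. Qed.

Definition jet_frame k a (t : jet A k) := curve_frame k a (jet_repr t).

Lemma jet_frame_inj k a (t u : jet A k) : adom a (jet_proj A k t) ->
  jet_proj A k t = jet_proj A k u -> jet_frame a t = jet_frame a u -> t = u.
Proof.
move=> at0 tu0 tuF; apply: eq_sig_hprop => [c p q|]; first exact: Prop_irrelevance.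
rewrite [LHS]jet_repr_class [RHS]jet_repr_class.
have st := jet_repr_smooth t; have su := jet_repr_smooth u.
have au0 : adom a (jet_repr u 0) by rewrite [X in adom a X](esym tu0).
apply/seteqP; split=> h [sh] /=.
  move/(jet_eq_frame k st sh at0) => [h0 hF]; split=> //.
  by apply/(jet_eq_frame k su sh au0); rewrite -h0 -hF; split.
move/(jet_eq_frame k su sh au0) => [h0 hF]; split=> //.
by apply/(jet_eq_frame k st sh at0); rewrite -h0 -hF; split.
Qed.

Lemma jet_of_curve k g : smooth_curve A g -> exists t : jet A k,
  jet_proj A k t = g 0 /\ forall a, adom a (g 0) -> jet_frame a t = curve_frame k a g.
Proof.
move=> sg; have [a ag0] := adom_cover hM (g 0).
pose t : jet A k := exist _ (jet_class A k g) (ex_intro2 _ _ g sg erefl).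
have st := jet_repr_smooth t.
have : jet_class A k g (jet_repr t).
  rewrite -[jet_class A k g]/(sval t) jet_repr_class; split=> //.
  have [b bt] := adom_cover hM (jet_repr t 0).
  by apply/(jet_eq_frame k st st bt).
move=> [_ gt]; exists t; split=> [|b bg0]; first by rewrite [RHS]gt.1.
by have [_ ->] := (jet_eq_frame k sg st bg0).1 gt.
Qed.

(** The Taylor polynomial with the required jet gives a curve. *)
Lemma jet_frame_surj k a x (z : {ffun 'I_k -> E}) : adom a x ->
  exists t : jet A k, jet_proj A k t = x /\ jet_frame a t = z.
Proof.
move=> ax; pose w := jet_of_frame (Gamma a) (achart a x, z).
have w1 : w.1 = achart a x by exact: unframe_fst.
have [|g [sg [S [oS S0 aS gS]]]] :=
  @exists_curve _ _ _ _ hM a (taylor_curve w) (taylor_curve_Cinfty w).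
  by rewrite taylor_curve0 crd0 w1; exists x.
have gx : g 0 = x.
  by apply: (chart_inj hM (aS _ S0) ax); rewrite gS// taylor_curve0 crd0 w1.
have [t [tg tF]] := jet_of_curve k sg; exists t; split; first by rewrite tg.
rewrite tF ?gx//.
have : jet_curve k (achart a \o g) 0 = w.
  rewrite -[RHS]jet_taylor_curve; congr pair; first exact: gS.
  by apply/ffunP => o; rewrite !ffunE; apply: (derive1n_eq _ oS).
move=> gw; have := curve_frame_jet k sg (aS _ S0).
rewrite gw (jet_of_frameK (dom1_open hM a) (hG.1 a)); last by exists x.
by move=> [].
Qed.

Lemma jet_frame_change k a b (t : jet A k) :
  adom a (jet_proj A k t) -> adom b (jet_proj A k t) -> jet_frame b t =
  [ffun o => fderiv (trans a b) (achart a (jet_proj A k t)) (jet_frame a t o)].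
Proof. by move=> at0 bt0; apply: curve_frame_change => //; apply: jet_repr_smooth. Qed.

End JetFrames.

(** * Bundles given by a cocycle *)

Section BundleMaps.
Context {R : realType} {E : normedModType R} {M : topologicalType}.
Context {A : atlas E M} (hM : smooth_manifold A).
Implicit Types (a b : aidx A) (x : M).

Lemma fst_open (F : normedModType R) (O : set E) : open O ->
  open [set w : E * F | O w.1].
Proof.
move=> oO; apply: (@open_comp _ _ (fstL E F) O) => // w _.
exact: (@clin_cont _ _ _ (fstL E F)).
Qed.

Lemma Cinfty_fst (F V : normedModType R) (O : set E) (f : E -> V) (S : set (E * F)) :
  open S -> (forall w, S w -> O w.1) -> Cinfty O f -> Cinfty S (fun w => f w.1).
Proof.
move=> oS SO Cf; apply: (Cinfty_comp oS SO _ Cf).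
exact: (Cinfty_clin (fstL E F)).
Qed.

Lemma local_rep_fun (V : normedModType R) (f : M -> V) a x : adom a x ->
  local_rep (AX := A) (AY := id_atlas V) f a tt (achart a x) = f x.
Proof.
move=> ax; apply: (@local_repE _ _ _ _ _ A (id_atlas V) f a tt (fun=> f x)) => //.
by move=> x' ax' _ /(chart_inj hM ax' ax)->.
Qed.

(** In charts the map is [(e, v) |-> (trans e, g(e) v)], which is smooth as soon
    as [g] is. *)
Lemma fiberwise_linear_smooth (F F' : normedModType R) (X X' : Type) (pr : X -> M)
    (T : @triv_cover R M F X) (pr' : X' -> M) (T' : @triv_cover R M F' X') (f : X -> X') :
  vector_bundle A pr T -> (forall j : tidx T', open (tdom j)) ->
  (forall z, pr' (f z) = pr z) ->
  (forall (i : tidx T) (j : tidx T'), exists2 g : M -> clin F F',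
    smooth_on A (id_atlas (clin F F')) (tdom i `&` tdom j) g &
    forall z, tdom i (pr z) -> tdom j (pr z) ->
      ttriv j (f z) = g (pr z) (ttriv i z)) ->
  smooth_on (total_atlas A pr T) (total_atlas A pr' T') setT f.
Proof.
move=> hT oT' prf loc [a i] [b j]; have [g sg gP] := loc i j.
have [oO1 Cg] := sg a tt.
pose P := adom a `&` tdom i `&` (adom b `&` tdom j).
pose O := [set w : E * F | (achart a @` P) w.1].
have oP : open (achart a @` P).
  apply: (chart_image_open hM); last by move=> x [[]].
  by do 2!apply: openI => //; try exact: (adom_open hM); exact: (tdom_open hT).
have oO : open O by exact: fst_open.
apply: (@smooth_on_chart _ _ _ _ _ _ _ _ _ _ _ O
  (fun w => (trans a b w.1, local_rep (AX := A) (AY := id_atlas _) g a tt w.1 w.2))) => //.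
- apply/seteqP; split=> [w [z [[_ [az iz]] [bz jz]] <-]|[e v] [x [[ax ix] [bx jx]] /= xe]].
    by move: bz jz; rewrite /= prf => bz jz; exists (pr z).
  have [_ _ /(_ (x, v))[|z iz [zx zv]]] := ttriv_bij hT i; first by split.
  exists z; last by rewrite /= zx zv xe.
  by split; [split=> //=; rewrite zx|rewrite /= prf zx].
- apply: Cinfty_pair => //.
    apply: (Cinfty_fst oO _ (trans_smooth hM a b)) => w [x [[ax ix] [bx jx]] xw].
    by exists x.
  apply: Cinfty_app => //; last exact: (Cinfty_clin (sndL E F)).
  apply: (Cinfty_fst oO _ Cg) => w [x [[ax ix] [bx jx]] xw].
  by exists x => //; do 2!split.
- move=> z [az iz]; rewrite /= prf => -[bz jz] _.
  by rewrite (transE hM)// local_rep_fun// gP.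
Qed.

Section SameCocycle.
Variables (F : normedModType R) (X X' : Type).
Variables (pr : X -> M) (pr' : X' -> M).
Variables (tau : aidx A -> X -> F) (tau' : aidx A -> X' -> F).
Let T := TrivCover (fun a => adom a) tau.
Let T' := TrivCover (fun a => adom a) tau'.
Variable gamma : aidx A -> aidx A -> M -> clin F F.
Hypothesis gamma_smooth : forall a b,
  smooth_on A (id_atlas (clin F F)) (adom a `&` adom b) (gamma a b).

(** A cocycle [gamma] together with bijective frames determines the bundle; both
    predicates are stated for an arbitrary space over [M], as they are applied to
    jets and to Whitney sums. *)
Definition has_cocycle (Y : Type) (prY : Y -> M) (tauY : aidx A -> Y -> F) :=
  forall a b z, adom a (prY z) -> adom b (prY z) ->
    tauY b z = gamma a b (prY z) (tauY a z).

Definition frame_bij (Y : Type) (prY : Y -> M) (tauY : aidx A -> Y -> F) :=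
  (forall a z z', adom a (prY z) -> prY z = prY z' -> tauY a z = tauY a z' -> z = z')
  /\ (forall a x v, adom a x -> exists z, prY z = x /\ tauY a z = v).

Lemma frame_vector_bundle : frame_bij pr tau -> has_cocycle pr tau ->
  vector_bundle A pr T.
Proof.
move=> [inj surj] coc; split=> /=.
- exact: (adom_cover hM).
- exact: (adom_open hM).
- move=> a; split.
  + by move=> z az.
  + move=> z z'; rewrite !inE => az _ [zz' tz]; exact: inj az zz' tz.
  + by move=> [x v] [/= ax _]; have [z [zx zv]] := surj a x v ax; exists z; rewrite /= ?zx ?zv.
- by move=> a b; exists (gamma a b) => // z az bz; apply: coc.
Qed.

(** Matching the frames in one chart at a point matches them in all charts, since
    both sides change by the same cocycle. *)
Lemma frame_transport : frame_bij pr' tau' -> has_cocycle pr tau ->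
  has_cocycle pr' tau' -> exists f : X -> X', forall z, pr' (f z) = pr z /\
    forall b, adom b (pr z) -> tau' b (f z) = tau b z.
Proof.
move=> [inj surj] coc coc'.
suff /choice : forall z, exists z', pr' z' = pr z /\
  forall b, adom b (pr z) -> tau' b z' = tau b z.
  by move=> [f fP]; exists f.
move=> z; have [a az] := adom_cover hM (pr z).
have [z' [zz' tz']] := surj a (pr z) (tau a z) az; exists z'; split=> // b bz.
by rewrite (coc' a b) ?zz'// tz' -coc.
Qed.

Lemma frame_morphism (f : X -> X') : vector_bundle A pr T -> has_cocycle pr tau ->
  (forall z, pr' (f z) = pr z /\ forall b, adom b (pr z) -> tau' b (f z) = tau b z) ->
  vb_morphism A pr T pr' T' f.
Proof.
move=> hT coc fP.
have loc (i : tidx T) (j : tidx T') : exists2 g : M -> clin F F,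
    smooth_on A (id_atlas (clin F F)) (tdom i `&` tdom j) g &
    forall z, tdom i (pr z) -> tdom j (pr z) -> ttriv j (f z) = g (pr z) (ttriv i z).
  exists (gamma i j) => [|z iz jz]; first exact: gamma_smooth.
  rewrite /= (fP z).2//; exact: coc.
have over z : pr' (f z) = pr z by have [] := fP z.
split=> //; apply: fiberwise_linear_smooth => //; exact: (adom_open hM).
Qed.

End SameCocycle.

Lemma same_cocycle_isomorphic (F : normedModType R) (X X' : Type)
    (pr : X -> M) (pr' : X' -> M) (tau : aidx A -> X -> F) (tau' : aidx A -> X' -> F)
    (gamma : aidx A -> aidx A -> M -> clin F F) :
  (forall a b, smooth_on A (id_atlas (clin F F)) (adom a `&` adom b) (gamma a b)) ->
  frame_bij pr tau -> frame_bij pr' tau' ->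
  has_cocycle gamma pr tau -> has_cocycle gamma pr' tau' ->
  vb_isomorphic A pr (TrivCover (fun a => adom a) tau)
    pr' (TrivCover (fun a => adom a) tau').
Proof.
move=> sg bij bij' coc coc'.
have [f fP] := frame_transport bij' coc coc'.
have [g gP] := frame_transport bij coc' coc.
have K (Y Y' : Type) (p : Y -> M) (p' : Y' -> M) (t : aidx A -> Y -> F) t'
    (u : Y -> Y') (v : Y' -> Y) : frame_bij p t ->
    (forall z, p' (u z) = p z /\ forall b, adom b (p z) -> t' b (u z) = t b z) ->
    (forall z, p (v z) = p' z /\ forall b, adom b (p' z) -> t b (v z) = t' b z) ->
    cancel u v.
  move=> [inj _] uP vP z; have [a az] := adom_cover hM (p z).
  have [vu tv] := vP (u z); have [uz tu] := uP z.
  apply: (inj a); first by rewrite vu uz.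
    by rewrite vu uz.
  by rewrite tv ?uz// tu.
exists f, g; split.
- exact: K fP gP.
- exact: K gP fP.
- by apply: (frame_morphism sg) => //; apply: (frame_vector_bundle sg).
- by apply: (frame_morphism sg) => //; apply: (frame_vector_bundle sg).
Qed.

End BundleMaps.

(** * The jet bundle of a connection *)

Section DiagonalMap.
Context {R : realType} {E : normedModType R} {I : finType}.

Fact diag_linear1 (f : {ffun I -> E}) :
  linear (fun l : clin E E => [ffun o => l (f o)] : {ffun I -> E}).
Proof. by move=> a l m; apply/ffunP => o; rewrite !ffunE. Qed.

Fact diag_linear2 (l : clin E E) :
  linear (fun f : {ffun I -> E} => [ffun o => l (f o)] : {ffun I -> E}).
Proof. by move=> a f g; apply/ffunP => o; rewrite !ffunE linearP. Qed.

Fact diag_bound (l : clin E E) (f : {ffun I -> E}) :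
  `|[ffun o => l (f o)] : {ffun I -> E}| <= 1 * `|l| * `|f|.
Proof.
rewrite mul1r; apply: ffun_norm_le => [|o]; first exact: mulr_ge0.
by rewrite ffunE (le_trans (clin_norm _ _))// ler_wpM2l// ffun_norm_ge.
Qed.

Definition diagB : clin (clin E E) (clin {ffun I -> E} {ffun I -> E}) :=
  mk_bilin ler01 diag_linear1 diag_linear2 diag_bound.

Lemma diagBE l f : diagB l f = [ffun o => l (f o)].
Proof. by []. Qed.

End DiagonalMap.

Section JetBundle.
Context {R : realType} {E : normedModType R} {M : topologicalType}.
Context {A : atlas E M} (hM : smooth_manifold A).
Variables (Gamma : aidx A -> E -> clin E (clin E E)).
Hypothesis (hG : linear_connection Gamma).
Variable k : nat.
Implicit Types (a b : aidx A) (x : M).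
Local Notation FE := {ffun 'I_k -> E}.

Definition tangent_cocycle a b x : clin FE FE :=
  diagB (fderiv (trans a b) (achart a x)).

Lemma tangent_cocycle_smooth a b :
  smooth_on A (id_atlas (clin FE FE)) (adom a `&` adom b) (tangent_cocycle a b).
Proof.
move=> c []; pose O := achart c @` (adom a `&` adom b `&` adom c).
have oO : open O.
  apply: (chart_image_open hM); last by move=> x [].
  by do 2?apply: openI; apply: (adom_open hM).
apply: (@smooth_on_chart _ _ _ _ _ _ _ _ _ _ _ O
  (fun e => diagB (fderiv (trans a b) (trans c a e)))) => //.
- by rewrite /O; congr (image _ _); rewrite preimage_setT setIT.
- apply: Cinfty_clin_comp => //.
  apply: (@Cinfty_comp _ _ _ _ _ (achart a @` (adom a `&` adom b))) => //.
  + by move=> _ [x [[ax bx] cx] <-]; exists x => //; rewrite (transE hM).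
  + by apply: Cinfty_sub (trans_smooth hM c a) => _ [x [[ax bx] cx] <-]; exists x.
  + exact/Cinfty_fderiv/(trans_smooth hM).
- move=> x cx _ Ox; have [[ax bx] _] := chart_image_mem hM (@subIsetr _ _ _) cx Ox.
  by rewrite /= (transE hM).
Qed.

Lemma jet_frame_bij : frame_bij (jet_proj A k) (fun a => jet_frame Gamma a).
Proof.
split=> [a z z' az zz' zF|a x v ax]; first exact: (jet_frame_inj hM hG az).
exact: (jet_frame_surj hM hG).
Qed.

Lemma jet_frame_cocycle :
  has_cocycle tangent_cocycle (jet_proj A k) (fun a => jet_frame Gamma a).
Proof.
move=> a b z az bz; rewrite /tangent_cocycle diagBE.
by rewrite (jet_frame_change hM hG az bz).
Qed.

Definition whitney_frame a (w : whitney k (@tangent_proj _ _ _ A)) : FE :=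
  [ffun l => (achart (a := jet_atlas A 1) a ((sval w).2 l)).2 ord0].

(** At order one the only frame vector is the velocity, and [1!] does not change
    it: frames of jets of order one are the usual coordinates of TM. *)
Lemma tangent_frameE a (t : tangent A) :
  (achart (a := jet_atlas A 1) a t).2 ord0 = jet_frame Gamma a t ord0.
Proof. by rewrite /= !ffunE/= invr1 scale1r. Qed.

Lemma whitney_frameE a w l :
  whitney_frame a w l = jet_frame Gamma a ((sval w).2 l) ord0.
Proof. by rewrite -tangent_frameE ffunE. Qed.

Lemma whitney_frame_bij : frame_bij whitney_proj whitney_frame.
Proof.
split=> [a [[x p] /= xp] [[y q] /= yq] /= ax xy pq|a x v ax].
  rewrite /whitney_proj/= in ax xy; subst y.
  apply: eq_sig_hprop => [c s s'|]; first exact: Prop_irrelevance.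
  congr pair; apply/funext => l; apply: (jet_frame_inj hM hG (a := a)).
  - by rewrite -[jet_proj _ _ _]/(tangent_proj _) xp.
  - by rewrite -[LHS]/(tangent_proj _) -[RHS]/(tangent_proj _) xp yq.
  - apply/ffunP => o; rewrite (ord1 o).
    by move/ffunP/(_ l): pq; rewrite !whitney_frameE.
have /choice[p pP] : forall l : 'I_k, exists t : tangent A,
    tangent_proj t = x /\ jet_frame Gamma a t = [ffun=> v l].
  by move=> l; apply: (jet_frame_surj hM hG).
pose Q (q : M * ('I_k -> tangent A)) := forall l, tangent_proj (q.2 l) = q.1.
exists (exist Q (x, p) (fun l => (pP l).1)); split=> //.
by apply/ffunP => l; rewrite whitney_frameE (pP l).2 ffunE.
Qed.

Lemma whitney_frame_cocycle :
  has_cocycle tangent_cocycle whitney_proj whitney_frame.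
Proof.
move=> a b [[x p] xp] ax bx; rewrite /whitney_proj /= in ax bx.
rewrite /tangent_cocycle diagBE; apply/ffunP => l.
rewrite [RHS]ffunE !whitney_frameE /=.
have pl : jet_proj A 1 (p l) = x := xp l.
have apl : adom a (jet_proj A 1 (p l)) by rewrite pl.
have bpl : adom b (jet_proj A 1 (p l)) by rewrite pl.
by rewrite (jet_frame_change hM hG apl bpl) ffunE pl.
Qed.

Definition jet_cover :=
  TrivCover (fun a => adom a) (fun a (t : jet A k) => jet_frame Gamma a t).

(** The charts of T^k M use Taylor coefficients and the frames use derivatives;
    the two differ by this rescaling. *)
Definition jet_scale (r : nat -> R) (w : E * FE) : E * FE :=
  (w.1, [ffun o : 'I_k => r o *: w.2 o]).

Lemma jet_scale_Cinfty r (S : set (E * FE)) : open S -> Cinfty S (jet_scale r).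
Proof.
move=> oS; apply: Cinfty_pair => //; first exact: (Cinfty_clin (fstL _ _)).
apply: Cinfty_ffun => // o.
exact: (Cinfty_clin (r o *: compL (ffun_atL E o) (sndL _ _))).
Qed.

Let up (o : nat) : R := o.+1`!%:R.
Let down (o : nat) : R := (o.+1`!%:R)^-1.

Lemma jet_scale_upK w : jet_scale down (jet_scale up w) = w.
Proof.
rewrite [RHS]surjective_pairing; congr pair; apply/ffunP => o.
by rewrite !ffunE scalerA mulVf ?scale1r// pnatr_eq0 -lt0n fact_gt0.
Qed.

Lemma jet_scale_downK w : jet_scale up (jet_scale down w) = w.
Proof.
rewrite [RHS]surjective_pairing; congr pair; apply/ffunP => o.
by rewrite !ffunE scalerA mulfV ?scale1r// pnatr_eq0 -lt0n fact_gt0.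
Qed.

Lemma jet_chartE b (t : jet A k) :
  achart (a := jet_atlas A k) b t =
  jet_scale down (jet_curve k (achart b \o jet_repr t) 0).
Proof. by congr pair; apply/ffunP => o; rewrite !ffunE. Qed.

Lemma jet_chart_frame b (t : jet A k) : adom b (jet_proj A k t) ->
  achart (a := jet_atlas A k) b t =
  jet_scale down (jet_of_frame (Gamma b) (achart b (jet_proj A k t), jet_frame Gamma b t)).
Proof.
by move=> bt; rewrite jet_chartE (jet_curve_frame hM hG)//; apply: jet_repr_smooth.
Qed.

Lemma frame_jet_chart b (t : jet A k) : adom b (jet_proj A k t) ->
  (achart b (jet_proj A k t), jet_frame Gamma b t) =
  frame_of_jet (Gamma b) (jet_scale up (achart (a := jet_atlas A k) b t)).
Proof.
move=> bt; rewrite jet_chart_frame// jet_scale_downK.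
by rewrite (jet_of_frameK (dom1_open hM b) (hG.1 b))//; exists (jet_proj A k t).
Qed.

(** From the frame in the chart [i] one passes linearly to the frame in the chart
    [b], and from there to the jet in the chart [b]. *)
Lemma frame_to_jet_smooth :
  smooth_on (total_atlas A (jet_proj A k) jet_cover) (jet_atlas A k) setT idfun.
Proof.
move=> [a i] b; change (aidx A) in i, b.
pose P := adom a `&` adom i `&` adom b.
have oP (c : aidx A) : P `<=` adom c -> open (achart c @` P).
  move=> Pc; apply: (chart_image_open hM) => //.
  by do 2?apply: openI; apply: (adom_open hM).
have Pa : P `<=` adom a by move=> x [[]].
pose O := [set w : E * FE | (achart a @` P) w.1].
have oO : open O by exact: (jdom_open (k := k) (oP a Pa)).
apply: (@smooth_on_chart _ _ _ _ _ _ _ _ _ _ _ O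
  (fun w => jet_scale down (jet_of_frame (Gamma b) (trans a b w.1,
     diagB (fderiv (trans i b) (trans a i w.1)) w.2)))).
- apply/seteqP; split=> [_ [t [[_ [at_ it]] bt] <-]|[e v] [x [[ax ix] bx] /= xe]].
    by exists (jet_proj A k t).
  have [t [tx tv]] := jet_frame_bij.2 i x v ix.
  exists t; last by rewrite /= tx tv xe.
  by split; [split=> //=; rewrite tx|rewrite /= tx].
- exact: oO.
- apply: (@Cinfty_comp _ _ _ _ _ setT) => //; last exact/jet_scale_Cinfty/openT.
  apply: (@Cinfty_comp _ _ _ _ _ (jdom (achart b @` adom b))) => //.
  + by move=> w [x [[ax ix] bx] xw]; rewrite /jdom/= -xw (transE hM)//; exists x.
  + apply: Cinfty_pair => //.
      by apply: (Cinfty_fst oO _ (trans_smooth hM a b)) => w [x [[ax ix] bx] xw]; exists x.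
    apply: Cinfty_app => //; last exact: (Cinfty_clin (sndL E FE)).
    apply: Cinfty_clin_comp => //.
    apply: (@Cinfty_comp _ _ _ _ _ (achart i @` (adom i `&` adom b))
      (fun w => trans a i w.1)) => //.
    * by move=> w [x [[ax ix] bx] xw]; rewrite -xw (transE hM)//; exists x.
    * by apply: (Cinfty_fst oO _ (trans_smooth hM a i)) => w [x [[ax ix] bx] xw]; exists x.
    * exact/Cinfty_fderiv/(trans_smooth hM).
  + exact: (jet_of_frame_Cinfty k (dom1_open hM b) (hG.1 b)).
- move=> t [at_ it] bt _; rewrite jet_chart_frame//.
  congr (jet_scale _ (jet_of_frame _ (_, _))).
    by rewrite /= (transE hM).
  by rewrite /= (transE hM)// (jet_frame_cocycle it bt).
Qed.

Lemma jet_to_frame_smooth :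
  smooth_on (jet_atlas A k) (total_atlas A (jet_proj A k) jet_cover) setT idfun.
Proof.
move=> b [a i]; change (aidx A) in i, b.
pose P := adom a `&` adom i `&` adom b.
have oP : open (achart b @` P).
  apply: (chart_image_open hM); last by move=> x [].
  by do 2?apply: openI; apply: (adom_open hM).
pose O := [set w : E * FE | (achart b @` P) w.1].
have oO : open O by exact: (jdom_open (k := k) oP).
apply: (@smooth_on_chart _ _ _ _ _ _ _ _ _ _ _ O
  (fun w => (trans b a w.1, diagB (fderiv (trans b i) w.1)
     (frame_of_jet (Gamma b) (jet_scale up w)).2))).
- apply/seteqP; split=> [_ [t [[_ bt] [at_ it]] <-]|[e v] [x [[ax ix] bx] /= xe]].
    by exists (jet_proj A k t).
  have [t [tx tv]] := jet_frame_bij.2 b x (frame_of_jet (Gamma b) (jet_scale up (e, v))).2 bx.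
  exists t; first by split; [split=> //=; rewrite tx|rewrite /= tx].
  have bt : adom b (jet_proj A k t) by rewrite tx.
  apply: etrans (jet_chart_frame bt) _; rewrite tx tv xe.
  have -> : (e, (frame_of_jet (Gamma b) (jet_scale up (e, v))).2) =
    frame_of_jet (Gamma b) (jet_scale up (e, v)) by [].
  rewrite (frame_of_jetK (dom1_open hM b) (hG.1 b)) ?jet_scale_upK//.
  by exists x.
- exact: oO.
- apply: Cinfty_pair => //.
    by apply: (Cinfty_fst oO _ (trans_smooth hM b a)) => w [x [[ax ix] bx] xw]; exists x.
  apply: Cinfty_app => //.
    apply: Cinfty_clin_comp => //.
    apply: (Cinfty_fst oO _ (Cinfty_fderiv (trans_smooth hM b i))).
    by move=> w [x [[ax ix] bx] xw]; exists x.
  suff CJ : Cinfty O (fun w => frame_of_jet (Gamma b) (jet_scale up w)).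
    exact: (Cinfty_clin_comp (sndL E FE) oO CJ).
  apply: (@Cinfty_comp _ _ _ _ _ (jdom (achart b @` adom b))) => //.
  + by move=> w [x [[ax ix] bx] xw]; exists x.
  + exact: jet_scale_Cinfty.
  + exact: (frame_of_jet_Cinfty k (dom1_open hM b) (hG.1 b)).
- move=> t bt [at_ it] _; rewrite -frame_jet_chart//.
  by rewrite /= (transE hM)// (jet_frame_cocycle bt it).
Qed.

End JetBundle.

Theorem connection_jet_bundle_splits (R : realType) (E : completeNormedModType R)
    (M : topologicalType) (A : atlas E M)
    (Gamma : aidx A -> E -> clin E (clin E E)) (k : nat) :
  smooth_manifold A -> linear_connection Gamma -> jet_bundle_splits A k.
Proof.
move=> hM hG.
have bij := jet_frame_bij hM hG k; have coc := @jet_frame_cocycle _ _ _ _ hM _ hG k.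
have smooth := tangent_cocycle_smooth hM (k := k).
exists {ffun 'I_k -> E}, (jet_cover Gamma k); split.
- exact: (frame_vector_bundle hM smooth bij coc).
- by split; [exact: frame_to_jet_smooth|exact: jet_to_frame_smooth].
- apply: (same_cocycle_isomorphic hM smooth bij _ coc).
    exact: (whitney_frame_bij hM hG).
  exact: (whitney_frame_cocycle hM hG).
Qed.

(** * Connections from a partition of unity *)

Section FlatConnection.
Context {R : realType} {E : normedModType R} {M : topologicalType}.
Context {A : atlas E M} (hM : smooth_manifold A).
Implicit Types (a b c : aidx A) (x : M).

(** The components in the chart [a] of the connection whose components in the
    chart [c] are zero: the transformation law with zero right-hand component
    reads [dpsi (Gamma xi y) = d2psi (xi, y)], to be solved with the inverse
    change of charts. *)
Definition flat_connection a c (e : E) : clin E (clin E E) :=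
  compL (compB E E E (fderiv (trans c a) (trans a c e))) (fderiv (fderiv (trans a c)) e).

Lemma flat_connectionE a c x xi y : adom a x -> adom c x ->
  flat_connection a c (achart a x) xi y =
  fderiv (trans c a) (achart c x) (fderiv (fderiv (trans a c)) (achart a x) xi y).
Proof. by move=> ax cx; rewrite -(transE hM ax cx). Qed.

Lemma flat_connection_smooth a c :
  Cinfty (achart a @` (adom a `&` adom c)) (flat_connection a c).
Proof.
have oO := dom2_open hM a c.
apply: (Cinfty_bilin (compB E (clin E E) (clin E E))) => //; last first.
  exact/Cinfty_fderiv/Cinfty_fderiv/(trans_smooth hM).
apply: Cinfty_clin_comp => //.
apply: (@Cinfty_comp _ _ _ _ _ (achart c @` (adom c `&` adom a))) => //.
- by move=> _ [x [ax cx] <-]; exists x => //; rewrite (transE hM).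
- exact: (trans_smooth hM).
- exact/Cinfty_fderiv/(trans_smooth hM).
Qed.

(** The chain rule for first derivatives is an identity between linear maps that
    depend smoothly on the point; it is differentiated as a bilinear expression,
    through [compB]. *)
Lemma fderiv2_trans_comp a b c x xi y : adom a x -> adom b x -> adom c x ->
  fderiv (fderiv (trans a c)) (achart a x) xi y =
  fderiv (fderiv (trans b c)) (achart b x) (fderiv (trans a b) (achart a x) xi)
    (fderiv (trans a b) (achart a x) y) +
  fderiv (trans b c) (achart b x) (fderiv (fderiv (trans a b)) (achart a x) xi y).
Proof.
move=> ax bx cx; set e := achart a x.
pose P := adom a `&` (adom b `&` adom c).
have near_e : {near e, (fun e' => compB E E E (fderiv (trans b c) (trans a b e'))
    (fderiv (trans a b) e')) =1 fderiv (trans a c)}.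
  apply: (@open_near_eq _ _ _ (achart a @` P)); last by exists x.
    apply: (chart_image_open hM); last by move=> y' [].
    by do 2?apply: openI; apply: (adom_open hM).
  move=> _ [z [az [bz cz]] <-]; apply: clin_ext => v.
  by rewrite (transE hM)//; apply: (fderiv_trans_comp hM).
have dab := has_fderiv_fderiv (trans_diff hM ax bx).
have ddab : has_fderiv (fderiv (trans a b)) e (fderiv (fderiv (trans a b)) e).
  apply: has_fderiv_fderiv.
  by apply: (Cinfty_diff (Cinfty_fderiv (trans_smooth hM a b))); exists x.
have tE : trans a b e = achart b x by exact: transE.
have bcx : (achart b @` (adom b `&` adom c)) (achart b x) by exists x.
have ddbc := has_fderiv_fderiv (Cinfty_diff (Cinfty_fderiv (trans_smooth hM b c)) bcx).
rewrite -tE in ddbc.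
have [_ dE] := has_fderiv_near near_e
  (has_fderiv_bilin (compB E E E) (has_fderiv_comp dab ddbc) ddab).
apply: etrans (congr1 (fun l : clin E (clin E E) => l xi y) dE) _.
by rewrite -tE.
Qed.

Lemma flat_connection_change a b c x xi y : adom a x -> adom b x -> adom c x ->
  fderiv (trans a b) (achart a x) (flat_connection a c (achart a x) xi y) =
  fderiv (fderiv (trans a b)) (achart a x) xi y +
  flat_connection b c (achart b x) (fderiv (trans a b) (achart a x) xi)
    (fderiv (trans a b) (achart a x) y).
Proof.
move=> ax bx cx.
pose D := fderiv (trans a b) (achart a x); rewrite -/D.
apply: etrans (congr1 D (flat_connectionE xi y ax cx)) _.
apply: etrans (fderiv_trans_comp hM _ cx ax bx) _.
apply: etrans (congr1 _ (fderiv2_trans_comp xi y ax bx cx)) _.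
apply: etrans (clin_funD _ _ _) _.
rewrite addrC; congr (_ + _); last exact/esym/flat_connectionE.
apply: etrans (fderiv_trans_comp hM _ bx cx bx) _.
exact: fderiv_trans_id.
Qed.

Lemma clin_sumE (I : Type) (r : seq I) (V W : normedModType R) (f : I -> clin V W) v :
  (\sum_(i <- r) f i) v = \sum_(i <- r) f i v.
Proof. exact: (big_morph (fun l : clin V W => l v)). Qed.

Lemma clin_fun_sum (I : Type) (r : seq I) (V W : normedModType R) (l : clin V W) (f : I -> V) :
  l (\sum_(i <- r) f i) = \sum_(i <- r) l (f i).
Proof. by apply: (big_morph l); [apply: clin_funD|apply: clin_fun0]. Qed.

(** The transformation law is affine in the connection, hence stable under means
    with weights of sum one; a term of weight zero need not satisfy it, as its
    chart may not be defined at the point. *)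
Lemma average_affine (I : eqType) (r : seq I) (w : I -> R) (D : clin E E) (d xi y : E)
    (f g : I -> clin E (clin E E)) : \sum_(i <- r) w i = 1 ->
  (forall i, i \in r -> w i = 0 \/ D (f i xi y) = d + g i (D xi) (D y)) ->
  D ((\sum_(i <- r) w i *: f i) xi y) = d + (\sum_(i <- r) w i *: g i) (D xi) (D y).
Proof.
move=> w1 fg; rewrite !clin_sumE clin_fun_sum.
rewrite -[X in X + _]scale1r -w1 scaler_suml -big_split.
apply: eq_big_seq => i ir.
rewrite -[RHS]/(w i *: d + (w i *: g i) (D xi) (D y)) !clinZ clin_funZ -scalerDr.
by have [->|->//] := fg i ir; rewrite !scale0r.
Qed.

Theorem partitionable_connection : partitionable A ->
  exists Gamma : aidx A -> E -> clin E (clin E E), linear_connection Gamma.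
Proof.
move=> pA; have [[a0 _]|none] := pselect (exists a : aidx A, True); last first.
  by exists (fun _ _ => 0); split=> a; case: none; exists a.
(* the cover by the chart domains; [s] selects a chart for each of them *)
pose C : set (set M) := range (fun a : aidx A => adom a).
have [||rho [rho_smooth rho_ge0 rho_supp rho_fin rho_sum]] := pA C.
- by move=> _ [a _ <-]; exact: (adom_open hM).
- by move=> x; have [a ax] := adom_cover hM x; exists (adom a) => //; exists a.
have /choice[s sP] : forall U : set M, exists c : aidx A, C U -> adom c = U.
  move=> U; have [[c _ cU]|nU] := pselect (C U); first by exists c.
  by exists a0 => /nU.
pose r U a := local_rep (AX := A) (AY := id_atlas R) (rho U) a tt.
pose Gamma a e : clin E (clin E E) :=
  \sum_(U \in C) r U a e *: flat_connection a (s U) e.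
have rE U a x : adom a x -> r U a (achart a x) = rho U x by exact: local_rep_fun.
(* near each point the sum over the cover is a sum over a fixed finite list,
   for every family that vanishes together with the weights *)
have finE x : exists2 N, nbhs x N & exists2 l : seq (set M),
    (forall U, U \in l -> C U) &
    forall (V : zmodType) (F : set M -> V) y, N y ->
      (forall U, rho U y = 0 -> F U = 0) -> \sum_(U \in C) F U = \sum_(U <- l) F U.
  have [N xN finD] := rho_fin x; exists N => //.
  set D := (X in finite_set X) in finD; exists (finmap.enum_fset (fset_set D)).
    by move=> U lU; have /set_mem[] : U \in D by rewrite -(in_fset_set finD).
  move=> V F y Ny F0; rewrite -fsbig_finite//; apply/esym/fsbig_widen.
    by move=> U [].
  move=> U [CU nDU] /=; apply: F0; apply: contrapT => rU; apply: nDU; split=> //.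
  by exists y; split=> //; apply/eqP.
(* a term is smooth on the whole chart domain: near points of [U] as a product,
   and elsewhere because the weight vanishes near them *)
have term_smooth a U : C U -> Cinfty (achart a @` adom a)
    (fun e => r U a e *: flat_connection a (s U) e).
  move=> CU; apply: Cinfty_local => _ [x ax <-].
  have [Ux|nUx] := pselect (U x).
    have oO := dom2_open hM a (s U).
    exists (achart a @` (adom a `&` adom (s U))).
      by exists x => //; split; rewrite // sP.
    apply: (Cinfty_bilin (scaleB (clin E (clin E E)))) => //.
      apply: Cinfty_sub ((rho_smooth U CU) a tt).2.
      by move=> _ [y [ay _] <-]; exists y.
    exact: flat_connection_smooth.
  pose K := closure [set x | rho U x != 0].
  exists (achart a @` (adom a `&` ~` K)).
    by exists x => //; split=> // /(rho_supp U CU).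
  have oO : open (achart a @` (adom a `&` ~` K)).
    apply: (chart_image_open hM); last by move=> y [].
    by apply: openI; [exact: (adom_open hM)|apply: closed_openC; apply: closed_closure].
  apply: Cinfty_eq (Cinfty_cst 0 oO) => // _ [y [ay nKy] <-].
  rewrite rE// (_ : rho U y = 0) ?scale0r//; apply: contrapT => /eqP ry.
  by apply: nKy; apply: subset_closure.
exists Gamma; split=> [a|a b _ xi y [x [ax bx] <-] /=].
  apply: Cinfty_local => _ [x ax <-].
  have [N xN [l lC lE]] := finE x.
  pose P := N^° `&` adom a.
  have oP : open (achart a @` P).
    apply: (chart_image_open hM); last by move=> z [].
    by apply: openI; [exact: open_interior|exact: (adom_open hM)].
  exists (achart a @` P); first by exists x.
  apply: (@Cinfty_eq _ _ _ _
    (fun e => \sum_(U <- l) r U a e *: flat_connection a (s U) e)) => //.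
    move=> _ [z [Nz az] <-]; apply/esym/(lE _ _ z); first exact: interior_subset Nz.
    by move=> U rz; rewrite rE// rz scale0r.
  rewrite /=; under eq_fun do rewrite big_seq.
  apply: Cinfty_sum => // U Ul; apply: Cinfty_sub (term_smooth a U (lC U Ul)).
  by move=> _ [z [_ az] <-]; exists z.
have [N xN [l lC lE]] := finE x; have Nx := nbhs_singleton xN.
have GE c : adom c x -> Gamma c (achart c x) =
    \sum_(U <- l) rho U x *: flat_connection c (s U) (achart c x).
  move=> cx; rewrite /Gamma (lE _ _ x)//.
    by apply: eq_bigr => U _; rewrite rE.
  by move=> U rU; rewrite rE// rU scale0r.
have r1 : \sum_(U <- l) rho U x = 1 by rewrite -(rho_sum x) (lE _ _ x).
have tE : trans a b (achart a x) = achart b x by exact: transE.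
rewrite -/(Gamma a _) -/(Gamma b _) tE (GE a ax) (GE b bx).
apply: average_affine => // U Ul; have [rU|rU] := eqVneq (rho U x) 0; first by left.
right; apply: flat_connection_change => //.
rewrite (sP U (lC U Ul)); apply: (rho_supp U (lC U Ul)).
exact: subset_closure.
Qed.

End FlatConnection.

Unset Implicit Arguments.

Theorem corollary3p7 (R : realType) (E : completeNormedModType R)
    (M : topologicalType) (A : atlas E M) (hM : smooth_manifold A) :
  (forall k : nat, (2 <= k)%N ->
     ((exists Gamma : aidx A -> E -> clin E (clin E E), linear_connection Gamma) ->
        jet_bundle_splits A k) /\
     (partitionable A -> jet_bundle_splits A k ->
        exists Gamma : aidx A -> E -> clin E (clin E E), linear_connection Gamma))
  /\
  (partitionable A ->
     (exists2 k : nat, (2 <= k)%N & jet_bundle_splits A k) ->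
     forall i : nat, (1 <= i)%N -> jet_bundle_splits A i).
Proof.
split=> [k _|pA _ i _].
  split=> [[Gamma hG]|pA _]; first exact: connection_jet_bundle_splits hM hG.
  exact: partitionable_connection.
have [Gamma hG] := partitionable_connection hM pA.
exact: connection_jet_bundle_splits hM hG.
Qed.
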